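(* Let $D$ be a disk diagram with a good stacking. Then the directed dual graph $\Gamma$ of $D$ is acyclic, i.e. it has no directed cycle.
   Context: A disk diagram is a compact contractible combinatorial 2-complex $D$ with a fixed embedding in the plane. The boundary path of each 2-cell is assumed to be an immersed (locally injective) closed cycle in the 1-skeleton. Good stacking. For a 2-complex $X$ with 2-cells $\{r_i\}$, let $w_i$ be the circle that is the domain of the attaching map $\phi_i:w_i\to X^1$ of $r_i$, let $W=\bigsqcup w_i$, and let $\Phi:W\to X^1$ be induced by $\{\phi_i\}$. Let $\rho_X,\rho_{\mathbb R}$ be the projections of $X^1\times\mathbb R$ to $X^1$ and $\mathbb R$. A stacking of $X$ is a continuous injection $\Psi:W\to X^1\times\mathbb R$ with $\Phi=\rho_X\circ\Psi$. It is good if for each $i$ there exist $h_i,\ell_i\in w_i$ such that $\rho_{\mathbb R}(\Psi(\ell_i))$ is lowest in $\rho_{\mathbb R}(\Psi(\Phi^{-1}(\Phi(\ell_i))))$ and $\rho_{\mathbb R}(\Psi(h_i))$ is highest in $\rho_{\mathbb R}(\Psi(\Phi^{-1}(\Phi(h_i))))$. Dual graph. The dual graph $\Gamma$ of a 2-complex has one vertex for each 2-cell. If $r_1$ and $r_2$ are 2-cells whose boundaries share a 1-cell $e$, then $\Gamma$ has an associated edge (said to be dual to $e$) whose endpoints are the corresponding vertices $v_1$ and $v_2$. Thus when $n$ 2-cells share a 1-cell $e$, all the edges in a complete graph on $n$ vertices are dual to $e$, and there are no edges dual to $e$ when $n\le 1$. Directing the dual graph. Given a stacking, $\Gamma$ is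 directed as follows: if the side of the 2-cell $r_1$ at $e$ (the part of its boundary cycle lying over $e$) is lower in the $\mathbb R$-coordinate than the side of the 2-cell $r_2$ at $e$, then the associated edge is directed from $v_1$ to $v_2$. *)

(* Defs.v *)
From HB Require Import structures.
From mathcomp Require Import all_boot all_order all_algebra.
From mathcomp Require Import all_classical all_reals all_analysis.

Set Implicit Arguments.
Unset Strict Implicit.
Unset Printing Implicit Defensive.

Import Order.TTheory GRing.Theory Num.Theory.
Import numFieldTopology.Exports numFieldNormedType.Exports.

Local Open Scope classical_set_scope.
Local Open Scope ring_scope.

Section DiskDiagrams.
Variable R : realType.

Definition plane := (R * R)%type.

Definition disk : set plane := [set p | p.1 ^+ 2 + p.2 ^+ 2 <= 1].
Definition open_disk : set plane := [set p | p.1 ^+ 2 + p.2 ^+ 2 < 1].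
Definition circle : set plane := [set p | p.1 ^+ 2 + p.2 ^+ 2 = 1].

Definition turn (t : R) : plane := (cos (2 * pi * t), sin (2 * pi * t)).

(* The circle is subdivided into n arcs like the boundary of a regular n-gon:
   0-cells [corner n k] and open 1-cells [circle_arc n k], for k < n. *)
Definition corner (n k : nat) : plane := turn (k%:R / n%:R).
Definition circle_arc (n k : nat) : set plane :=
  turn @` [set t | k%:R / n%:R < t < k.+1%:R / n%:R].

Section Cells.
Variables (T : topologicalType) (V E F : finType).
Variables (vchar : V -> T) (echar : E -> R -> T) (fchar : F -> plane -> T).

Definition open_edge (e : E) : set T := echar e @` [set t | 0 < t < 1].
Definition open_face (f : F) : set T := fchar f @` open_disk.
Definition open_cell (c : V + E + F) : set T :=
  match c with
  | inl (inl v) => [set vchar v]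
  | inl (inr e) => open_edge e
  | inr f => open_face f
  end.

End Cells.

(* A finite (equivalently, compact) combinatorial 2-complex realised as a
   subset of T.  Cells are given by characteristic maps, of which only the
   restrictions to [0, 1] and to the closed unit disk are meaningful; as T is
   Hausdorff and there are finitely many cells, the subspace topology on the
   union of the cells is the CW topology.  [fchar f] restricted to [circle] is
   the attaching map of f; it is combinatorial for the subdivision of the
   circle into [flen f] arcs: corners go to 0-cells and each open arc is mapped
   bijectively (hence, by continuity, homeomorphically) onto an open 1-cell. *)
Record complex (T : topologicalType) := Complex {
  vertex : finType;
  edge : finType;
  face : finType;
  vchar : vertex -> T;
  echar : edge -> R -> T;
  fchar : face -> plane -> T;
  flen : face -> nat;
  complex_hausdorff : hausdorff_space T;
  echar_continuous : forall e, {within `[0, 1], continuous (echar e)};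
  echar_end : forall e,
    range vchar (echar e 0) /\ range vchar (echar e 1);
  echar_inj : forall e, set_inj [set t | 0 < t < 1] (echar e);
  fchar_continuous : forall f, {within disk, continuous (fchar f)};
  fchar_inj : forall f, set_inj open_disk (fchar f);
  flen_gt0 : forall f, (0 < flen f)%N;
  fchar_corner : forall f (k : 'I_(flen f)),
    range vchar (fchar f (corner (flen f) k));
  fchar_arc : forall f (k : 'I_(flen f)),
    exists e, set_bij (circle_arc (flen f) k) (open_edge echar e) (fchar f);
  vchar_inj : injective vchar;
  cells_disjoint : trivIset setT (open_cell vchar echar fchar) }.

Section Complex.
Variables (T : topologicalType) (X : complex T).

Definition support : set T :=
  \bigcup_c open_cell (@vchar T X) (@echar T X) (@fchar T X) c.

Definition immersed_boundaries : Prop :=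
  forall (f : face X) p, circle p ->
    exists2 U, nbhs p U & set_inj (U `&` circle) (fchar f).

(* A map out of W, the disjoint union of the circles w_f over the 2-cells f, is
   represented by a function of f and of a point of the plane, whose values
   outside [circle] are irrelevant. *)
Definition stacking (Psi : face X -> plane -> T * R) : Prop :=
  [/\ forall f, {within circle, continuous (Psi f)},
      forall f g p q, circle p -> circle q -> Psi f p = Psi g q ->
        f = g /\ p = q
    & forall f p, circle p -> (Psi f p).1 = fchar f p].

Definition good_stacking (Psi : face X -> plane -> T * R) : Prop :=
  stacking Psi /\
  forall f, exists h l, [/\ circle h, circle l,
    forall g q, circle q -> fchar g q = fchar f l ->
      (Psi f l).2 <= (Psi g q).2
  & forall g q, circle q -> fchar g q = fchar f h ->
      (Psi g q).2 <= (Psi f h).2].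

Definition side (f : face X) (e : edge X) (k : 'I_(flen f)) : Prop :=
  fchar f @` circle_arc (flen f) k = open_edge (@echar T X) e.

Definition lower_side (Psi : face X -> plane -> T * R) (f g : face X)
    (i : 'I_(flen f)) (j : 'I_(flen g)) : Prop :=
  forall p q, circle_arc (flen f) i p -> circle_arc (flen g) j q ->
    fchar f p = fchar g q -> (Psi f p).2 < (Psi g q).2.

(* The edge dual to e joins f and g and is directed from f to g. *)
Definition dual_edge (Psi : face X -> plane -> T * R) (e : edge X)
    (f g : face X) : Prop :=
  f <> g /\ exists (i : 'I_(flen f)) (j : 'I_(flen g)),
    [/\ side e i, side e j & lower_side Psi i j].

Definition dual_graph (Psi : face X -> plane -> T * R) : rel (face X) :=
  fun f g => `[< exists e, dual_edge Psi e f g >].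

End Complex.

Definition contractible (T : topologicalType) (A : set T) : Prop :=
  exists (x0 : T) (H : R * T -> T),
    [/\ A x0, {within `[0, 1] `*` A, continuous H},
        forall (t : R) x, 0 <= t <= 1 -> A x -> A (H (t, x)),
        forall x, A x -> H (0, x) = x
      & forall x, A x -> H (1, x) = x0].

Record disk_diagram := DiskDiagram {
  diagram :> complex plane;
  diagram_contractible : contractible (support diagram);
  diagram_immersed : immersed_boundaries diagram }.

End DiskDiagrams.

Definition acyclic (G : eqType) (r : rel G) : Prop :=
  forall c : seq G, c != [::] -> ~~ cycle r c.

(* Main.v *)
Require Import Defs.
From mathcomp Require Import all_boot all_order all_algebra.
From mathcomp Require Import all_classical all_reals all_analysis.
From mathcomp Require Import lra zify ring.

(** For a set S of faces, a point of a boundary circle is called top if it is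
    the highest point of its fibre among the circles of S.  Top points form an
    open set, and an open side is either entirely top or contains no top point;
    so at a top corner both adjacent sides are top.  Hence a face of S with a
    top point has more top sides than top corners, unless its whole circle is
    top.  Every vertex covered by S has a top corner and every edge at most one
    top side, so if no face of S were entirely top, then
    #edges >= #vertices + #faces, i.e. the complex spanned by S would have
    Euler characteristic at most 0.

    A contractible complex has trivial first cohomology, hence Euler
    characteristic at least 1, so some face t is entirely top.  It is a sink of
    the dual graph restricted to S.  The lowest point of t has a fibre with a
    single element, so t has an edge e lying on no other side in S; removing t
    and e is a collapse, which preserves exactness.  Repeating this removes all
    the faces, each being a sink among the remaining ones. *)

Set Implicit Arguments.
Unset Strict Implicit.
Unset Printing Implicit Defensive.

Import Order.TTheory GRing.Theory Num.Theory.
Import numFieldTopology.Exports numFieldNormedType.Exports.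

Local Open Scope classical_set_scope.
Local Open Scope ring_scope.

(** * Continuity on subsets, and fibres of maps from compact sets *)

Lemma within_continuousP (S T : topologicalType) (A : set S) (c : S -> T) :
  {within A, continuous c} <->
  forall x U, A x -> nbhs (c x) U -> \forall y \near x, A y -> U (c y).
Proof.
rewrite subspace_continuousP; split => [h x U Ax Uc|h x Ax U Uc].
  exact: (h x Ax _ Uc).
exact: (h x U Ax Uc).
Qed.

Lemma continuous_pair (S T U : topologicalType) (f : S -> T) (g : S -> U) x :
  {for x, continuous f} -> {for x, continuous g} ->
  {for x, continuous (fun x => (f x, g x))}.
Proof. by move=> cf cg; apply: cvg_pair. Qed.

Lemma slice_continuous (S T : topologicalType) (a : S) :
  continuous (fun x : T => (a, x)).
Proof. by move=> x; apply: cvg_pair; [exact: cvg_cst|exact: cvg_id]. Qed.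

(** A tube lemma for fibres. A point of [K] whose image is not [x0] is separated from [x0] by
    Hausdorffness and drops out near it. So [P] need only hold locally at the points of the fibre
    over [x0], and compactness makes it uniform. *)
Lemma near_fiber (X T : topologicalType) (Y : Type) (F : set_system Y)
    (K : set X) (k : X -> T) (c : Y -> T) (x0 : T) (P : Y -> X -> Prop) :
  Filter F -> hausdorff_space T -> compact K -> {within K, continuous k} ->
  c @ F --> x0 ->
  (forall s, K s -> k s = x0 ->
    \forall s' \near s & y \near F, K s' -> P y s') ->
  \forall y \near F, forall s, K s -> k s = c y -> P y s.
Proof.
move=> FF hT /compact_near_coveringP cK /within_continuousP ck cc hP.
have := cK Y F (fun y s => K s -> k s = c y -> P y s) FF.
set concl := (X in (_ -> X) -> _) => h; suff: concl.
  by apply: filterS => y Py s Ks; exact: (Py s Ks Ks).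
apply: h => s Ks.
have [kx|/eqP kx] := pselect (k s = x0).
  by have := hP s Ks kx; apply: filterS => -[s' y] /= Py Ks' _; exact: Py.
move: hT; rewrite open_hausdorff => /(_ _ _ kx)[[A B] /= []].
rewrite !inE => Ax Bx [oA oB AB0].
exists ([set s' | K s' -> A (k s')], [set y | B (c y)]) => /=.
  split; first by apply: ck => //; exact: open_nbhs_nbhs.
  by apply: cc; exact: open_nbhs_nbhs.
move=> [s' y] /= [As' By] Ks' e; exfalso.
have : (A `&` B) (c y) by split => //; rewrite -e; exact: As'.
by rewrite AB0.
Qed.

(** * Real functions continuous modulo 1 *)

Section ContZ.
Context {R : realType}.
Implicit Types (r eps : R).

Definition nearZ eps r := exists2 m : R, m \is a Num.int & `|r - m| < eps.

Lemma nearZ_lt eps r : `|r| < eps -> nearZ eps r.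
Proof. by move=> h; exists 0; rewrite ?subr0 // rpred0. Qed.

Lemma nearZD eps eps' r s :
  nearZ eps r -> nearZ eps' s -> nearZ (eps + eps') (r + s).
Proof.
move=> [m mi hm] [n ni hn]; exists (m + n); first exact: rpredD.
rewrite opprD addrACA; apply: le_lt_trans (ler_normD _ _) _; exact: ltrD.
Qed.

Lemma nearZN eps r : nearZ eps r -> nearZ eps (- r).
Proof.
move=> [m mi hm]; exists (- m); first by rewrite rpredN.
by rewrite -opprD normrN.
Qed.

Lemma nearZ_addint eps r m : m \is a Num.int -> nearZ eps r -> nearZ eps (r + m).
Proof.
move=> mi [n ni hn]; exists (n + m); first exact: rpredD.
by rewrite opprD addrACA subrr addr0.
Qed.

(** Continuity of the induced map to R/Z, tested at the points of [A] along the points of [B].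
    Keeping the two sets apart allows gluing over finite unions of sets [B]. *)
Definition contZ (T : topologicalType) (A B : set T) (u : T -> R) :=
  forall x eps, A x -> 0 < eps -> \forall y \near x, B y -> nearZ eps (u y - u x).

Lemma contZ_comp (S T : topologicalType) (A : set S) (B : set T) (c : S -> T)
    (u : T -> R) :
  {within A, continuous c} -> (forall x, A x -> B (c x)) -> contZ B B u ->
  contZ A A (u \o c).
Proof.
move=> /within_continuousP cc AB cu x eps Ax e0.
have := cc x _ Ax (cu _ _ (AB _ Ax) e0).
by apply: filterS => y h Ay; apply: h => //; exact: AB.
Qed.

Lemma contZB (T : topologicalType) (A B : set T) (u v : T -> R) :
  contZ A B u -> contZ A B v -> contZ A B (fun x => u x - v x).
Proof.
move=> cu cv x eps Ax e0; have e2 : 0 < eps / 2 by rewrite divr_gt0.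
apply: filterS2 (cu x _ Ax e2) (cv x _ Ax e2) => y h h' By.
rewrite [eps]splitr (_ : _ - _ = (u y - u x) - (v y - v x)); last lra.
by apply: nearZD (h By) _; apply: nearZN; exact: h'.
Qed.

(** A continuous map from a compact space to a Hausdorff one is a quotient map onto its image, so
    continuity modulo 1 can be read off from a continuous real function [l] upstairs. *)
Lemma contZ_image (X T : topologicalType) (K : set X) (k : X -> T) (l : X -> R)
    (u : T -> R) :
  hausdorff_space T -> compact K -> {within K, continuous k} ->
  {within K, continuous l} ->
  (forall s, K s -> u (k s) - l s \is a Num.int) ->
  contZ setT (k @` K) u.
Proof.
move=> hT cK ck /within_continuousP cl ul x eps _ e0.
have : \forall y \near x,
    forall s, K s -> k s = y -> y = k s -> nearZ eps (u y - u x); last first.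
  by apply: filterS => y hy [s Ks ks]; exact: (hy s Ks ks (esym ks)).
apply: (@near_fiber X T T (nbhs x) K k id x
  (fun y s => y = k s -> nearZ eps (u y - u x))) => //.
move=> s Ks ksx.
exists ([set s' | K s' -> `|l s' - l s| < eps], setT) => /=.
  split; last exact: filterT.
  have := cl s _ Ks (nbhsx_ballx (l s) eps e0).
  by apply: filterS => s' h2 Ks'; rewrite distrC; exact: h2.
move=> [s' y] /= [hs' _] Ks' ->; rewrite -ksx.
have -> : u (k s') - u (k s) =
  (l s' - l s) + ((u (k s') - l s') - (u (k s) - l s)) by lra.
apply: nearZ_addint; first by rewrite rpredB // ul.
exact/nearZ_lt/hs'.
Qed.

Lemma contZ_bigcup (T : topologicalType) (I : finType) (A : set T)
    (B : I -> set T) (u : T -> R) :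
  (forall i, contZ A (B i) u) -> contZ A (\bigcup_i B i) u.
Proof.
move=> h x eps Ax e0.
have := filter_forall (nbhs_filter x) (fun i => h i x eps Ax e0).
by apply: filterS => y hy [i _ Bi]; exact: (hy i Bi).
Qed.

Lemma contZS (T : topologicalType) (A A' B B' : set T) (u : T -> R) :
  A `<=` A' -> B `<=` B' -> contZ A' B' u -> contZ A B u.
Proof.
move=> AA BB h x eps Ax e0; have := h x eps (AA _ Ax) e0.
by apply: filterS => y hy By; apply: hy; exact: BB.
Qed.

Lemma small_int r : r \is a Num.int -> `|r| < 1 -> r = 0.
Proof.
move=> /intrP[m ->]; rewrite -intr_norm ltrz1 => h.
by have -> : m = 0 by lia.
Qed.

(** The representative of [r] modulo 1 in [-1/2, 1/2). *)
Let residue r : R := r - (Num.floor (r + 2^-1))%:~R.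

Let residue_int r : r - residue r \is a Num.int.
Proof. by rewrite /residue opprB addrC subrK intr_int. Qed.

Let residue_lt r : nearZ 4^-1 r -> `|residue r| < 4^-1.
Proof.
move=> [m mi]; rewrite ltr_distl => /andP[h1 h2].
suff -> : residue r = r - m by rewrite ltr_distl; apply/andP; split.
move: mi h1 h2 => /intrP[k ->] h1 h2; rewrite /residue.
rewrite (@floor_def _ _ k) // intrD; apply/andP; split; lra.
Qed.

Lemma within_continuous_sum (T : topologicalType) (A : set T) (I : Type)
    (s : seq I) (f : I -> T -> R) :
  (forall i, {within A, continuous f i}) ->
  {within A, continuous (fun x => \sum_(i <- s) f i x)}.
Proof.
move=> cf; elim: s => [|i s IH] x.
  rewrite (_ : (fun x => _) = fun=> 0); first exact: cvg_cst.
  by apply/funext => y; rewrite big_nil.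
rewrite (_ : (fun x => _) = (fun x => f i x + \sum_(j <- s) f j x)).
  by apply: cvgD; [exact: cf|exact: IH].
by apply/funext => y; rewrite big_cons.
Qed.

(** Follow the contraction from the identity to the constant map in steps so short that [u] moves by
    less than 1/4 modulo 1 in each. Every increment then has a continuous real representative, its
    residue, and the increments telescope. *)
Lemma contZ_lift (T : topologicalType) (A : set T) (u : T -> R) :
  compact A -> contractible R A -> contZ A A u ->
  exists g : T -> R,
    {within A, continuous g} /\ forall x, A x -> u x - g x \is a Num.int.
Proof.
move=> cA [x0 [H [Ax0 cH HA H0 H1]]] cu.
pose K : set (R * T) := `[0, 1] `*` A.
have cK : compact K by apply: compact_setX => //; exact: segment_compact.
have KP t x : K (t, x) <-> 0 <= t <= 1 /\ A x.
  by rewrite /K /= in_itv.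
pose v := u \o H.
have cv : contZ K K v.
  apply: contZ_comp cu => // -[t x] /KP[h Ax]; exact: HA.
(* [P n p] says that time changes of at most 1/(n+1) are short enough at [p]; compactness of [K]
   gives one [n] that serves all points. *)
pose P (n : nat) (p : R * T) := forall t', 0 <= t' <= 1 ->
  `|p.1 - t'| <= n.+1%:R^-1 -> nearZ 4^-1 (v p - v (t', p.2)).
have [N hN] : exists N, K `<=` P N.
  apply: (@filter_ex _ \oo).
  have /compact_near_coveringP/near_covering_withinP h := cK.
  apply: (h _ \oo P) => -[t x] Ktx.
  have e8 : 0 < 8^-1 :> R by rewrite invr_gt0.
  have [[U V] /= [Ut Vx] UV] := cv _ _ Ktx e8.
  have [r /= r0 rU] := Ut.
  have r2 : 0 < r / 2 by rewrite divr_gt0.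
  exists ([set p | U p.1 /\ V p.2 /\ `|t - p.1| < r / 2],
          [set n : nat | n.+1%:R^-1 < r / 2]) => /=.
    split; last exact: near_infty_natSinv_lt (PosNum r2).
    exists (U `&` ball t (r / 2), V) => /=.
      by split => //; apply: filterI => //; exact: nbhsx_ballx.
    by move=> [a b] /= [[Ua ta] Vb]; split.
  move=> [[t1 x1] n] /= [[Ut1 [Vx1 tt1]] nr] /KP[t1I Ax1] t' t'I /= tt'.
  have h1 := UV (t1, x1) (conj Ut1 Vx1) ((KP _ _).2 (conj t1I Ax1)).
  have Ut' : U t'.
    apply: rU; rewrite /= (_ : t - t' = (t - t1) + (t1 - t')); last lra.
    apply: le_lt_trans (ler_normD _ _) _.
    rewrite [ltRHS]splitr; apply: ltrD => //; exact: le_lt_trans nr.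
  have h2 := UV (t', x1) (conj Ut' Vx1) ((KP _ _).2 (conj t'I Ax1)).
  have := nearZD h1 (nearZN h2).
  by congr nearZ; [lra|rewrite opprB addrA subrK].
pose t (i : nat) : R := i%:R / N.+1%:R.
have N0 : 0 < N.+1%:R :> R by rewrite ltr0n.
have tI i : (i <= N.+1)%N -> 0 <= t i <= 1.
  move=> h; rewrite /t divr_ge0 ?ler0n //= ler_pdivrMr // mul1r ler_nat //.
pose d i x := v (t i, x) - v (t i.+1, x).
have dnear i x : (i < N.+1)%N -> A x -> nearZ 4^-1 (d i x).
  move=> iN Ax; apply: (hN (t i, x)); [|exact: tI|].
    by apply/KP; split => //; apply: tI; exact: ltnW.
  rewrite /= /t -mulrBl -natr1 opprD addrA subrr add0r mulN1r normrN.
  by rewrite ger0_norm // invr_ge0 ltW.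
have cd i : (i < N.+1)%N -> {within A, continuous (fun x => residue (d i x))}.
  move=> iN; have cdi : contZ A A (d i).
    apply: contZB.
      apply: (@contZ_comp _ _ A K (fun x => (t i, x)) v) => //; last first.
        by move=> x Ax; apply/KP; split => //; apply: tI; exact: ltnW.
      exact/continuous_subspaceT/slice_continuous.
    apply: (@contZ_comp _ _ A K (fun x => (t i.+1, x)) v) => //; last first.
      by move=> x Ax; apply/KP; split => //; exact: tI.
    exact/continuous_subspaceT/slice_continuous.
  apply/within_continuousP => x U Ax [eps /= e0 hU].
  have e0' : 0 < Num.min eps 4^-1 by rewrite lt_min e0 invr_gt0 /=.
  have := cdi x _ Ax e0'; apply: filterS => y hy Ay; apply: hU => /=.
  have [m mi] := hy Ay; rewrite lt_min => /andP[h1 h2].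
  have r1 := residue_lt (dnear i x iN Ax).
  have r2 := residue_lt (dnear i y iN Ay).
  (* The integer [k] combines two residues and the error [d i y - d i x - m], each below 1/4 in
     absolute value, so it is 0 and the residues differ by exactly that error. *)
  pose k := m - (d i y - residue (d i y)) + (d i x - residue (d i x)).
  have ki : k \is a Num.int by rewrite rpredD // rpredB.
  have k0 : k = 0.
    apply: small_int => //.
    have -> : k = (residue (d i y) - residue (d i x)) - (d i y - d i x - m).
      by rewrite /k; lra.
    apply: le_lt_trans (ler_normB _ _) _.
    have := ler_normB (residue (d i y)) (residue (d i x)); lra.
  rewrite distrC (_ : _ - _ = d i y - d i x - m) //.
  by move: k0; rewrite /k; lra.
exists (fun x => u x0 + \sum_(i < N.+1) residue (d i x)); split.
  move=> x; apply: cvgD; first exact: cvg_cst.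
  by apply: within_continuous_sum => i; exact: cd.
move=> x Ax.
have -> : u x = u x0 + \sum_(i < N.+1) d i x.
  rewrite -(big_mkord xpredT (fun i => d i x)).
  have -> : \sum_(0 <= i < N.+1) d i x =
      - \sum_(0 <= i < N.+1) (v (t i.+1, x) - v (t i, x)).
    by rewrite -sumrN; apply: eq_bigr => i _; rewrite opprB.
  rewrite telescope_sumr // opprB /v /= /t mul0r divff ?gt_eqF // H0 // H1 //.
  by rewrite addrC subrK.
rewrite opprD addrACA subrr add0r -sumrB rpred_sum // => i _; exact: residue_int.
Qed.

(** Distinct integer values differ by at least 1, so the intermediate value theorem would produce a
    half-integral value between them. *)
Lemma int_continuous_const (f : R -> R) (a b : R) : a <= b ->
  {within `[a, b], continuous f} ->
  (forall t, a <= t <= b -> f t \is a Num.int) -> f a = f b.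
Proof.
move=> ab cf fi.
have ia : f a \is a Num.int by apply: fi; rewrite lexx.
have ib : f b \is a Num.int by apply: fi; rewrite lexx andbT.
have ni (c : R) : c \is a Num.int -> c + 2^-1 \is a Num.int -> False.
  move=> ic ic'; have := rpredB ic' ic; rewrite addrAC subrr add0r.
  move=> hi; have := small_int hi; rewrite ger0_norm; last lra.
  move=> h; have : (2^-1 : R) = 0 by apply: h; lra.
  lra.
case: (ltgtP (f a) (f b)) => // h; exfalso.
  have : f a + 1 <= f b.
    move: ia ib h => /intrP[m ->] /intrP[n ->]; rewrite ltr_int -intrD1 ler_int; lia.
  move=> h'; have [|c] := @IVT R f a b (f a + 2^-1) ab cf.
    rewrite min_l ?max_r ?(ltW h) //; apply/andP; split; lra.
  rewrite in_itv /= => /fi ic e; apply: (ni (f a)) => //; rewrite -e //.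
have : f b + 1 <= f a.
  move: ia ib h => /intrP[m ->] /intrP[n ->]; rewrite ltr_int -intrD1 ler_int; lia.
move=> h'; have [|c] := @IVT R f a b (f b + 2^-1) ab cf.
  rewrite min_r ?max_l ?(ltW h) //; apply/andP; split; lra.
rewrite in_itv /= => /fi ic e; apply: (ni (f b)) => //; rewrite -e //.
Qed.

End ContZ.

(** Connectedness of the interval: the indicator function of [P] is continuous and
    integer-valued. *)
Lemma locally_constant (R : realType) (a b : R) (P : R -> Prop) : a <= b ->
  (forall x, a <= x <= b -> P x -> \forall y \near x, P y) ->
  (forall x, a <= x <= b -> ~ P x -> \forall y \near x, ~ P y) ->
  P a <-> P b.
Proof.
move=> ab hP hN; pose g x : R := (`[< P x >])%:R.
suff : g a = g b.
  rewrite /g => /eqP; rewrite eqr_nat => e; split => /asboolP h; apply/asboolP.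
    by move: e; rewrite h; case: asbool.
  by move: e; rewrite h; case: asbool.
apply: int_continuous_const => //; last by move=> t _; rewrite natr_int.
apply/within_continuousP => x U; rewrite /= in_itv /= => hx hU.
have [Px|nPx] := pselect (P x).
  have := hP x hx Px; apply: filterS => y Py _.
  by move/nbhs_singleton: hU; rewrite /g !asboolT.
have := hN x hx nPx; apply: filterS => y Py _.
by move/nbhs_singleton: hU; rewrite /g !asboolF.
Qed.

Lemma near_itv (R : realType) (a b c : R) (P : R -> Prop) : a < b ->
  a <= c <= b -> (\forall s \near c, P s) -> exists2 s, a < s < b & P s.
Proof.
move=> ab /andP[ac cb] [eps /= e0 heps].
pose d := Num.min (eps / (b - a)) 1.
have ba : 0 < b - a by rewrite subr_gt0.
have d0 : 0 < d by rewrite lt_min divr_gt0 //= ltr01.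
have d1 : d <= 1 by rewrite ge_min lexx orbT.
have de : d * (b - a) <= eps by rewrite -ler_pdivlMr // ge_min lexx.
(* [s] slides from [c] towards the midpoint by the fraction [d], which puts it inside the open
   interval and within [eps] of [c]. *)
pose s := (1 - d) * c + d * ((a + b) / 2).
exists s; first by rewrite /s; apply/andP; split; nra.
apply: heps; rewrite /= (_ : c - s = d * (c - (a + b) / 2)); last first.
  by rewrite /s; ring.
rewrite normrM gtr0_norm //.
have : `|c - (a + b) / 2| < b - a by rewrite ltr_norml; apply/andP; split; lra.
by move=> h; apply: lt_le_trans de; rewrite ltr_pM2l.
Qed.

(** The value halfway between [L a] and the value at the midpoint is attained on each half of the
    interval. *)
Lemma loop_not_injective (R : realType) (L : R -> R) (a b : R) : a < b ->
  {within `[a, b], continuous L} -> L a = L b ->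
  (forall t, a < t < b -> L t != L a) ->
  exists s t, [/\ a < s < b, a < t < b, s != t & L s = L t].
Proof.
move=> ab cL Lab La.
pose c := (a + b) / 2; pose y := (L a + L c) / 2.
have hc : a < c < b by rewrite /c; apply/andP; split; lra.
have := La c hc; case/andP: hc => ac cb /eqP Lac.
have sub1 : `[a, c] `<=` `[a, b].
  by move=> t /=; rewrite !in_itv /= => /andP[? ?]; apply/andP; split; lra.
have sub2 : `[c, b] `<=` `[a, b].
  by move=> t /=; rewrite !in_itv /= => /andP[? ?]; apply/andP; split; lra.
have [|s] := @IVT R L a c y (ltW ac) (continuous_subspaceW sub1 cL).
  rewrite /y; case: (leP (L a) (L c)) => h; apply/andP; split; lra.
rewrite in_itv /= => /andP[s1 s2] Ls.
have [|t] := @IVT R L c b y (ltW cb) (continuous_subspaceW sub2 cL).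
  rewrite /y -Lab; case: (leP (L c) (L a)) => h; apply/andP; split; lra.
rewrite in_itv /= => /andP[t1 t2] Lt.
have yc : y <> L c by move=> e; apply: Lac; move: e; rewrite /y; lra.
have ya : y <> L a by move=> e; apply: Lac; move: e; rewrite /y; lra.
have sa : s != a by apply/eqP => e; apply: ya; rewrite -Ls e.
have sc : s != c by apply/eqP => e; apply: yc; rewrite -Ls e.
have tc : t != c by apply/eqP => e; apply: yc; rewrite -Lt e.
have tb : t != b by apply/eqP => e; apply: ya; rewrite -Lt e Lab.
have s1' : a < s by rewrite lt_neqAle eq_sym sa.
have s2' : s < c by rewrite lt_neqAle sc.
have t1' : c < t by rewrite lt_neqAle eq_sym tc.
have t2' : t < b by rewrite lt_neqAle tb.
exists s, t; split; rewrite ?Ls ?Lt //; try by apply/andP; split; lra.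
by rewrite lt_eqF // (lt_trans s2').
Qed.

(** * Polar coordinates on the disk *)

Section Turn.
Context {R : realType}.
Implicit Types (s t : R).

Lemma circle_turn t : circle (turn t).
Proof. exact: cos2Dsin2. Qed.

Lemma turn_continuous : continuous (@turn R).
Proof.
move=> t.
apply: (@continuous_pair _ _ _ (fun t => cos (2 * pi * t))
  (fun t => sin (2 * pi * t))).
  apply: (@continuous_comp _ _ _ (fun t => 2 * pi * t) (@cos R)).
    exact: mulrl_continuous.
  exact: continuous_cos.
apply: (@continuous_comp _ _ _ (fun t => 2 * pi * t) (@sin R)).
  exact: mulrl_continuous.
exact: continuous_sin.
Qed.

Lemma turnD1 t : turn (t + 1) = turn t.
Proof. by rewrite /turn mulrDr mulr1 (mulrC 2) mulr_natr cosD2pi sinD2pi. Qed.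

Lemma turn1 : turn 1 = turn 0 :> plane R.
Proof. by rewrite -[in LHS](add0r 1) turnD1. Qed.

Lemma turn_surj (p : plane R) : circle p -> exists2 t, 0 <= t < 1 & turn t = p.
Proof.
case: p => a b; rewrite /circle /= => ab1.
have b2 : b ^+ 2 >= 0 by exact: sqr_ge0.
have a2 : a ^+ 2 >= 0 by exact: sqr_ge0.
have aI : -1 <= a <= 1.
  have a21 : a * a <= 1 by rewrite -expr2; lra.
  by apply/andP; split; nra.
have pi0 : 0 < pi :> R := pi_gt0 R.
have tpi (x : R) : 2 * pi * (x / (2 * pi)) = x.
  by rewrite mulrCA mulfV ?mulr1 // gt_eqF // mulr_gt0.
have [c0 cpi] := (acos_ge0 aI, acos_lepi aI).
have sq : sin (acos a) = `|b|.
  by rewrite sin_acos // (_ : 1 - a ^+ 2 = b ^+ 2) ?sqrtr_sqr //; lra.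
have ca : cos (acos a) = a by rewrite acosK // in_itv.
(* [acos] gives an angle in [0, pi]; for negative [b] it is negated, and a full turn is added to
   return to [0, 1). *)
have [b0|b0] := leP 0 b.
  exists (acos a / (2 * pi)).
    apply/andP; split; first by rewrite divr_ge0 // mulr_ge0 // ltW.
    by rewrite ltr_pdivrMr ?mulr_gt0 // mul1r; lra.
  by rewrite /turn tpi ca sq ger0_norm.
have c0' : 0 < acos a.
  rewrite lt_neqAle c0 andbT; apply/eqP => h; move: sq.
  by rewrite -h sin0 => /esym/eqP; rewrite normr_eq0 lt_eqF.
exists (- (acos a / (2 * pi)) + 1).
  have : acos a / (2 * pi) < 1 by rewrite ltr_pdivrMr ?mulr_gt0 // mul1r; lra.
  have : 0 < acos a / (2 * pi) by rewrite divr_gt0 // mulr_gt0.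
  by move=> h1 h2; apply/andP; split; lra.
rewrite turnD1 /turn mulrN tpi cosN sinN ca sq ltr0_norm // opprK //.
Qed.

Lemma turn_inj s t : 0 <= s < 1 -> 0 <= t < 1 -> turn s = turn t -> s = t.
Proof.
wlog le_st : s t / s <= t => [h hs ht e|].
  by case/orP: (le_total s t) => l; [|apply: esym]; apply: h.
move=> /andP[s0 s1] /andP[t0 t1] [ec es].
have pi0 : 0 < pi :> R := pi_gt0 R.
(* Half the angle between the two points: [cos (d *+ 2) = 1] forces [sin d = 0], whereas 0 < d < pi
   would make it positive. *)
pose d := pi * (t - s).
have cd : cos (d *+ 2) = 1.
  rewrite (_ : d *+ 2 = 2 * pi * t - 2 * pi * s); last by rewrite /d mulr2n; ring.
  by rewrite cosB ec es -!expr2 cos2Dsin2.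
have sd : sin d = 0.
  apply/eqP; rewrite -sqrf_eq0; apply/eqP; move: cd; rewrite cos_mulr2n => h.
  by rewrite sin2cos2; lra.
apply/eqP; rewrite eq_le le_st /= leNgt; apply/negP => lt_st.
suff : 0 < sin d by rewrite sd ltxx.
apply: sin_gt0_pi; rewrite mulr_gt0 ?subr_gt0 //=.
by rewrite gtr_pMr //; lra.
Qed.

Lemma subdivide (n : nat) t : (0 < n)%N -> 0 <= t < 1 ->
  exists k : 'I_n, t = k%:R / n%:R \/ k%:R / n%:R < t < k.+1%:R / n%:R.
Proof.
move=> n0 /andP[t0 t1]; have n0' : 0 < n%:R :> R by rewrite ltr0n.
have tn0 : 0 <= t * n%:R by rewrite mulr_ge0 // ltW.
have /andP[h1 h2] := truncn_itv tn0.
have kn : (Num.truncn (t * n%:R) < n)%N.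
  rewrite -(ltr_nat R); apply: le_lt_trans h1 _.
  by rewrite -[ltRHS]mul1r ltr_pM2r.
exists (Ordinal kn) => /=.
have := h1; rewrite le_eqVlt => /orP[/eqP->|h]; [left|right].
  by rewrite mulfK // gt_eqF.
by rewrite ltr_pdivrMr // h ltr_pdivlMr.
Qed.

Lemma subdivision_le1 (n k : nat) : (k < n)%N ->
  0 <= k%:R / n%:R :> R /\ k.+1%:R / n%:R <= 1 :> R.
Proof.
move=> kn; have n0' : 0 < n%:R :> R by rewrite ltr0n (leq_ltn_trans _ kn).
by split; [rewrite divr_ge0|rewrite ler_pdivrMr // mul1r ler_nat].
Qed.

Lemma ltr_subdivision (n k l : nat) : (0 < n)%N ->
  (k%:R / n%:R < l%:R / n%:R :> R) = (k < l)%N.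
Proof. by move=> n0; rewrite ltr_pM2r ?ltr_nat // invr_gt0 ltr0n. Qed.

Lemma subdivision_uniq (n k l : nat) t : (0 < n)%N ->
  k%:R / n%:R < t < k.+1%:R / n%:R -> l%:R / n%:R < t < l.+1%:R / n%:R -> k = l.
Proof.
move=> n0 /andP[k1 k2] /andP[l1 l2].
have := lt_trans k1 l2; have := lt_trans l1 k2.
by rewrite !ltr_subdivision // => ? ?; lia.
Qed.

Definition polar (p : R * R) : plane R :=
  (p.1 * (turn p.2).1, p.1 * (turn p.2).2).

Lemma polar1 t : polar (1, t) = turn t.
Proof. by rewrite /polar !mul1r. Qed.

Lemma polar_sqr (p : R * R) : (polar p).1 ^+ 2 + (polar p).2 ^+ 2 = p.1 ^+ 2.
Proof. by rewrite !exprMn -mulrDr [X in _ * X]circle_turn mulr1. Qed.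

Lemma disk_polar (p : R * R) : 0 <= p.1 <= 1 -> disk (polar p).
Proof.
move=> /andP[p0 p1]; change ((polar p).1 ^+ 2 + (polar p).2 ^+ 2 <= 1).
by rewrite polar_sqr expr_le1.
Qed.

Lemma open_disk_polar (p : R * R) : 0 <= p.1 < 1 -> open_disk (polar p).
Proof.
move=> /andP[p0 p1]; change ((polar p).1 ^+ 2 + (polar p).2 ^+ 2 < 1).
by rewrite polar_sqr expr_lt1.
Qed.

Lemma polar_continuous : continuous polar.
Proof.
move=> p; apply: (@continuous_pair _ _ _ (fun p : R * R => p.1 * (turn p.2).1)
  (fun p : R * R => p.1 * (turn p.2).2)); apply: cvgM; try exact: cvg_fst.
  apply: (@continuous_comp _ _ _ (fun p : R * R => turn p.2) fst).
    apply: (@continuous_comp _ _ _ snd (@turn R)); first exact: cvg_snd.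
    exact: turn_continuous.
  exact: cvg_fst.
apply: (@continuous_comp _ _ _ (fun p : R * R => turn p.2) snd).
  apply: (@continuous_comp _ _ _ snd (@turn R)); first exact: cvg_snd.
  exact: turn_continuous.
exact: cvg_snd.
Qed.

Lemma polar_surj (q : plane R) : disk q ->
  exists s t, [/\ 0 <= s <= 1, 0 <= t < 1 & polar (s, t) = q].
Proof.
case: q => a b; rewrite /disk /= => ab1.
have ab0 : 0 <= a ^+ 2 + b ^+ 2 by rewrite addr_ge0 ?sqr_ge0.
pose s := Num.sqrt (a ^+ 2 + b ^+ 2).
have s2 : s ^+ 2 = a ^+ 2 + b ^+ 2 by rewrite sqr_sqrtr.
have s0 : 0 <= s by exact: sqrtr_ge0.
have s1 : s <= 1 by rewrite -(ler_pXn2r (n:=2)) ?nnegrE // expr1n s2.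
have [sz|sz] := eqVneq s 0.
  exists 0, 0; split; rewrite ?lexx ?ler01 ?ltr01 //.
  move: s2; rewrite sz expr0n /= => /esym/eqP.
  by rewrite paddr_eq0 ?sqr_ge0 // !sqrf_eq0 => /andP[/eqP-> /eqP->];
    rewrite /polar /= !mul0r.
have [|t ht e] := @turn_surj (a / s, b / s).
  by rewrite /circle /= !exprMn -mulrDl -s2 exprVn mulfV // sqrf_eq0.
exists s, t; split; rewrite ?s0 //.
have -> : polar (s, t) = (s * (turn t).1, s * (turn t).2) by [].
by rewrite e /= !(mulrC s) !divfK.
Qed.

Lemma polar_eq (p q : R * R) : 0 <= p.1 -> 0 <= q.1 -> polar p = polar q ->
  p.1 = q.1 /\ (p.1 = 0 \/ turn p.2 = turn q.2).
Proof.
move=> p0 q0 e.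
have sq : p.1 ^+ 2 = q.1 ^+ 2.
  by rewrite -(polar_sqr q) -e; apply/esym; exact: polar_sqr.
have e1 : p.1 = q.1 by apply/eqP; rewrite -(@eqrXn2 _ 2) // sq.
split => //; have [->|pz] := eqVneq p.1 0; [by left|right].
have h1 : p.1 * (turn p.2).1 = p.1 * (turn q.2).1.
  by rewrite [in RHS]e1; exact: (congr1 fst e).
have h2 : p.1 * (turn p.2).2 = p.1 * (turn q.2).2.
  by rewrite [in RHS]e1; exact: (congr1 snd e).
rewrite (surjective_pairing (turn p.2)) (surjective_pairing (turn q.2)).
by rewrite (mulfI pz h1) (mulfI pz h2).
Qed.

Lemma turn_ends s t : 0 <= s <= 1 -> 0 <= t <= 1 -> turn s = turn t ->
  s = t \/ (s = 0 \/ s = 1) /\ (t = 0 \/ t = 1).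
Proof.
move=> /andP[s0]; rewrite le_eqVlt => /orP[/eqP->|s1].
  move=> /andP[t0]; rewrite le_eqVlt => /orP[/eqP->|t1]; first by left.
  by rewrite turn1 => /turn_inj <-; rewrite ?lexx ?ltr01 ?t0 //; auto.
move=> /andP[t0]; rewrite le_eqVlt => /orP[/eqP->|t1].
  by rewrite turn1 => /turn_inj ->; rewrite ?lexx ?ltr01 ?s0 //; auto.
by move=> /turn_inj ->; rewrite ?s0 ?t0 //; left.
Qed.

End Turn.

Lemma compact_bigcup_fin (T : topologicalType) (I : finType) (F : I -> set T) :
  (forall i, compact (F i)) -> compact (\bigcup_i F i).
Proof.
move=> cF; apply/compact_near_coveringP => J G P FG h.
have := filter_forall FG (fun i => (compact_near_coveringP _).1 (cF i) J G P FG _).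
set hyp := (X in (X -> _) -> _) => h'; suff : hyp.
  by move/h'; apply: filterS => j hj x [i _ Fi]; exact: hj Fi.
by move=> i x Fi; apply: h; exists i.
Qed.

(** * Open cells and the 1-skeleton *)

Section Complex.
Context {R : realType} {T : topologicalType} (X : complex R T).
Implicit Types (v : vertex X) (e : edge X) (f : face X).

Local Notation open_edge := (open_edge (@echar R T X)).
Local Notation open_face := (open_face (@fchar R T X)).
Local Notation open_cell := (open_cell (@vchar R T X) (@echar R T X) (@fchar R T X)).
Local Notation hausT := (complex_hausdorff X).

Lemma cell_uniq c c' x : open_cell c x -> open_cell c' x -> c = c'.
Proof. by move=> h h'; apply: (@cells_disjoint R T X) => //; exists x. Qed.

Lemma open_edge_vchar e v : ~ open_edge e (vchar v).
Proof.
by move=> h; have := @cell_uniq (inl (inr e)) (inl (inl v)) _ h erefl.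
Qed.

Lemma open_edge_uniq e e' x : open_edge e x -> open_edge e' x -> e = e'.
Proof.
by move=> h h'; have [] := @cell_uniq (inl (inr e)) (inl (inr e')) _ h h'.
Qed.

Definition skel1 : set T :=
  [set x | (exists v, vchar v = x) \/ (exists e, open_edge e x)].

Lemma open_face_skel1 f x : open_face f x -> ~ skel1 x.
Proof.
move=> h [[v vx]|[e ex]].
  by have := @cell_uniq (inr f) (inl (inl v)) _ h (esym vx).
by have := @cell_uniq (inr f) (inl (inr e)) _ h ex.
Qed.

Lemma open_face_uniq f f' x : open_face f x -> open_face f' x -> f = f'.
Proof. by move=> h h'; have [] := @cell_uniq (inr f) (inr f') _ h h'. Qed.

Lemma echar_cases e (t : R) : 0 <= t <= 1 ->
  [\/ t = 0, t = 1 | 0 < t < 1 /\ open_edge e (echar e t)].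
Proof.
rewrite 2!le_eqVlt => /andP[/orP[/eqP<-|t0] /orP[/eqP t1|t1]];
  [constructor 1|constructor 1|constructor 2|constructor 3] => //.
by rewrite t0 t1; split => //; exists t; rewrite //= t0.
Qed.

Lemma echar_skel1 e (t : R) : 0 <= t <= 1 -> skel1 (echar e t).
Proof.
case/(echar_cases e) => [->|->|[_ h]]; last by right; exists e.
  by have [[v _ <-] _] := echar_end e; left; exists v.
by have [_ [v _ <-]] := echar_end e; left; exists v.
Qed.

(** * Boundary paths *)

Definition bd f (t : R) : T := fchar f (turn t).

Lemma circle_disk (p : plane R) : circle p -> disk p.
Proof. by rewrite /disk /circle /= => ->. Qed.

Lemma bd_continuous f : continuous (bd f).
Proof.
move=> t U Ut; change (\forall s \near t, U (bd f s)).
have /within_continuousP cf := @fchar_continuous _ _ X f.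
have h := cf (turn t) U (circle_disk (circle_turn t)) Ut.
have : \forall s \near t, disk (turn s) -> U (bd f s) by exact: turn_continuous h.
apply: filterS => s hs.
exact/hs/circle_disk/circle_turn.
Qed.

Lemma bdD1 f t : bd f (t + 1) = bd f t.
Proof. by rewrite /bd turnD1. Qed.

Lemma bd_corner f (k : 'I_(flen f)) : exists v, vchar v = bd f (k%:R / (flen f)%:R).
Proof. by have [v _ h] := fchar_corner k; exists v. Qed.

Lemma bd_corner_succ f (k : 'I_(flen f)) :
  exists v, vchar v = bd f (k.+1%:R / (flen f)%:R).
Proof.
have [kn|kn] := ltnP k.+1 (flen f); first exact: bd_corner (Ordinal kn).
have n0 := flen_gt0 f.
have -> : k.+1 = flen f by have := ltn_ord k; lia.
rewrite divff ?pnatr_eq0; last lia.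
rewrite -[1]add0r bdD1; have := bd_corner (Ordinal n0).
by rewrite mul0r.
Qed.

Definition in_arc f (k : 'I_(flen f)) (t : R) :=
  k%:R / (flen f)%:R < t < k.+1%:R / (flen f)%:R.

Lemma in_arc01 f (k : 'I_(flen f)) t : in_arc k t -> 0 <= t < 1.
Proof.
move=> /andP[h1 h2]; have [h3 h4] := @subdivision_le1 R _ _ (ltn_ord k).
by apply/andP; split; lra.
Qed.

Lemma in_arc_uniq f (k l : 'I_(flen f)) t : in_arc k t -> in_arc l t -> k = l.
Proof.
by move=> hk hl; apply/val_inj/(subdivision_uniq (flen_gt0 f) hk hl).
Qed.

Lemma arc_edge_ex f (k : 'I_(flen f)) : {e | set_bij (circle_arc (flen f) k)
  (open_edge e) (fchar f)}.
Proof. exact/cid/fchar_arc. Qed.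

Definition arc_edge f (k : 'I_(flen f)) := projT1 (arc_edge_ex k).

Lemma bd_arc f (k : 'I_(flen f)) t : in_arc k t -> open_edge (arc_edge k) (bd f t).
Proof.
move=> tk; rewrite /arc_edge; case: arc_edge_ex => e /= [+ _ _]; apply.
by exists t.
Qed.

Lemma bd_arc_inj f (k : 'I_(flen f)) s t :
  in_arc k s -> in_arc k t -> bd f s = bd f t -> s = t.
Proof.
move=> sk tk; have [_ + _] := projT2 (arc_edge_ex k) => inj e.
apply: turn_inj; [exact: in_arc01 sk|exact: in_arc01 tk|].
by apply: inj => //; rewrite inE; [exists s|exists t].
Qed.

Lemma bd_arc_surj f (k : 'I_(flen f)) x :
  open_edge (arc_edge k) x -> exists2 t, in_arc k t & bd f t = x.
Proof.
have [_ _ surj] := projT2 (arc_edge_ex k).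
by move=> /surj[_ [t tk <-] <-]; exists t.
Qed.

Lemma bd_cases f t : 0 <= t < 1 -> exists k : 'I_(flen f),
  t = k%:R / (flen f)%:R \/ in_arc k t.
Proof. exact: subdivide (flen_gt0 f). Qed.

Lemma bd_skel1 f t : skel1 (bd f t).
Proof.
have [s hs e] := turn_surj (circle_turn t); rewrite /bd -e.
have [k [->|/bd_arc h]] := bd_cases f hs; first by left; exact: bd_corner.
by right; exists (arc_edge k).
Qed.

(** * Integral first cohomology *)

(** Modulo 1 and on the 1-skeleton, this is the map to R/Z that wraps [e] once around and collapses
    the rest to 0. The default 0 is what both ends of [e] receive. *)
Definition edge_coord e (x : T) : R := xget 0 [set t | 0 < t < 1 /\ echar e t = x].

Lemma coord_echar e t : 0 < t < 1 -> edge_coord e (echar e t) = t.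
Proof.
move=> ht; apply: xget_unique => // s [hs est].
by apply: (@echar_inj _ _ X e) => //; rewrite inE.
Qed.

Lemma coord_notin e x : ~ open_edge e x -> edge_coord e x = 0.
Proof. by move=> h; apply: xgetPN => t [ht etx]; apply: h; exists t. Qed.

Lemma coord_in e x : open_edge e x ->
  0 < edge_coord e x < 1 /\ echar e (edge_coord e x) = x.
Proof. by move=> [t ht <-]; rewrite coord_echar. Qed.

Lemma coord_echar_int e e' t : 0 <= t <= 1 ->
  edge_coord e (echar e' t) - (e == e')%:R * t \is a Num.int.
Proof.
case/(echar_cases e') => [->|->|[ht h]].
- have [[v _ <-] _] := echar_end e'.
  by rewrite coord_notin ?mulr0 ?subr0 ?rpred0 //; exact: open_edge_vchar.
- have [_ [v _ <-]] := echar_end e'.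
  rewrite coord_notin ?mulr1; last exact: open_edge_vchar.
  by rewrite rpredB ?rpred0 // intr_nat // natr_int.
- have [->|ne] := eqVneq e e'; first by rewrite coord_echar // mul1r subrr rpred0.
  rewrite coord_notin ?mul0r ?subrr ?rpred0 // => h'.
  by move/eqP: ne; apply; exact: open_edge_uniq h' h.
Qed.

(** The 1-skeleton is covered by finitely many images of points and intervals; over the edge [e],
    [u] agrees modulo 1 with the continuous function [z e * t]. *)
Lemma contZ_skel1 (u : T -> R) (z : edge X -> R) :
  (forall e t, 0 <= t <= 1 -> u (echar e t) - z e * t \is a Num.int) ->
  contZ setT skel1 u.
Proof.
move=> hu.
have cV : contZ setT (\bigcup_(v : vertex X) [set vchar v]) u.
  apply: contZ_bigcup => v.
  have -> : [set vchar v] = (fun _ : R => vchar v) @` [set 0].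
    by apply/seteqP; split => [x ->|_ [t _ <-]] //; exists 0.
  apply: (contZ_image hausT (l := fun=> u (vchar v))).
  - exact: compact_set1.
  - exact/continuous_subspaceT/cst_continuous.
  - exact/continuous_subspaceT/cst_continuous.
  - by move=> s _; rewrite subrr rpred0.
have cE : contZ setT (\bigcup_(e : edge X) (echar e @` `[0, 1])) u.
  apply: contZ_bigcup => e.
  apply: (contZ_image hausT (l := fun t => z e * t)).
  - exact: segment_compact.
  - exact: echar_continuous.
  - exact/continuous_subspaceT/mulrl_continuous.
  - by move=> t /=; rewrite in_itv; exact: hu.
move=> x eps _ e0.
apply: filterS2 (cV x eps I e0) (cE x eps I e0) => y hV hE [[v vy]|[e [t ht ey]]].
  by apply: hV; exists v.
apply: hE; exists e => //; exists t => //=; rewrite in_itv /=.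
by move: ht => /andP[/ltW-> /ltW->].
Qed.

Lemma contractible_segment : contractible R (`[0, 1] : set R).
Proof.
exists 0, (fun p => (1 - p.1) * p.2); split.
- by rewrite /= in_itv /= lexx ler01.
- apply: continuous_subspaceT => p; apply: cvgM; last exact: cvg_snd.
  by apply: cvgB; [exact: cvg_cst|exact: cvg_fst].
- move=> t x /andP[t0 t1]; rewrite /= !in_itv /= => /andP[x0 x1].
  by rewrite mulr_ge0 ?subr_ge0 //= mulr_ile1 ?subr_ge0 // lerBlDr lerDl.
- by move=> x _; rewrite subr0 mul1r.
- by move=> x _; rewrite subrr mul0r.
Qed.

Lemma bd_lift_ex f e : {L : R -> R | {within `[0, 1], continuous L} /\
  forall t, 0 <= t <= 1 -> edge_coord e (bd f t) - L t \is a Num.int}.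
Proof.
apply/cid.
have c1 : contZ (`[0, 1] : set R) `[0, 1] (edge_coord e \o bd f).
  apply: (@contZ_comp _ _ _ _ skel1) => [|t _|].
  - exact/continuous_subspaceT/bd_continuous.
  - exact: bd_skel1.
  - apply: (@contZS _ _ _ setT _ skel1) => //.
    apply: (@contZ_skel1 _ (fun e' => (e == e')%:R)) => e' t.
    exact: coord_echar_int.
have [L [cL hL]] := contZ_lift (@segment_compact R 0 1) contractible_segment c1.
by exists L; split => // t ht; apply: hL; rewrite /= in_itv.
Qed.

Definition bd_lift f e : R -> R := projT1 (bd_lift_ex f e).

Lemma bd_lift_continuous f e : {within `[0, 1], continuous (bd_lift f e)}.
Proof. by have [] := projT2 (bd_lift_ex f e). Qed.

Lemma bd_liftP f e t : 0 <= t <= 1 ->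
  edge_coord e (bd f t) - bd_lift f e t \is a Num.int.
Proof. by have [_ +] := projT2 (bd_lift_ex f e); exact. Qed.

(** The winding number of the boundary path of [f] along [e], i.e. the coefficient of [e] in the
    cellular boundary of [f]. The floor turns an integral real number into an [int]. *)
Definition wind f e : int := Num.floor (bd_lift f e 1 - bd_lift f e 0).

Lemma windE f e : (wind f e)%:~R = bd_lift f e 1 - bd_lift f e 0.
Proof.
rewrite /wind floorK //.
have h1 : edge_coord e (bd f 1) - bd_lift f e 1 \is a Num.int.
  by apply: bd_liftP; rewrite lexx ler01.
have h0 : edge_coord e (bd f 0) - bd_lift f e 0 \is a Num.int.
  by apply: bd_liftP; rewrite lexx ler01.
move: h1; have -> : bd f 1 = bd f 0 by rewrite /bd turn1.
move=> h1; have := rpredB h0 h1.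
by rewrite (_ : _ - _ - _ = bd_lift f e 1 - bd_lift f e 0) //; lra.
Qed.

Lemma supportE : Defs.support X =
  skel1 `|` \bigcup_(f : face X) ((fchar f \o polar) @` (`[0, 1] `*` `[0, 1])).
Proof.
apply/seteqP; split => x.
  move=> [[[v|e]|f] _ /= h]; [by left; left; exists v|by left; right; exists e|].
  right; exists f => //; case: h => p hp <-.
  have [|s [t [hs /andP[t0 t1] <-]]] := @polar_surj R p; first exact: ltW.
  by exists (s, t) => //; split; rewrite /= in_itv //= t0 ltW.
case; first by move=> [[v <-]|[e h]]; [exists (inl (inl v))|exists (inl (inr e))].
move=> [f _ [[s t] [/=]]]; rewrite !in_itv /= => /andP[s0 s1] _ <-.
move: s1; rewrite le_eqVlt => /orP[/eqP->|s1].
  rewrite polar1; have [[v e]|[e h]] := bd_skel1 f t.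
    by exists (inl (inl v)) => //=; rewrite e.
  by exists (inl (inr e)).
exists (inr f) => //=; exists (polar (s, t)) => //.
by apply: open_disk_polar; rewrite s0.
Qed.

Lemma compact_skel1 : compact skel1.
Proof.
have -> : skel1 = \bigcup_(v : vertex X) [set vchar v] `|`
    \bigcup_(e : edge X) (echar e @` `[0, 1]).
  apply/seteqP; split => x.
    move=> [[v <-]|[e [t ht <-]]]; [by left; exists v|right; exists e => //].
    exists t => //=; rewrite in_itv /=; by move: ht => /andP[/ltW-> /ltW->].
  move=> [[v _ ->]|[e _ [t]]]; first by left; exists v.
  by rewrite /= in_itv => ht <-; exact: echar_skel1.
apply: compactU; apply: compact_bigcup_fin; first by move=> v; exact: compact_set1.
by move=> e; apply: continuous_compact; [exact: echar_continuous|exact: segment_compact].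
Qed.

Lemma face_polar_continuous f :
  {within `[0, 1] `*` `[0, 1], continuous (fchar f \o polar)}.
Proof.
have /within_continuousP cf := @fchar_continuous _ _ X f.
apply/within_continuousP => p U [/= hp _] hU.
have dp q : q.1 \in `[0 : R, 1] -> disk (polar q).
  by rewrite in_itv /=; exact: disk_polar.
have h := cf (polar p) U (dp _ hp) hU.
have : \forall q \near p, disk (polar q) -> U (fchar f (polar q)).
  exact: polar_continuous h.
apply: filterS => q h' [hq _].
exact/h'/dp.
Qed.

Lemma compact_support : compact (Defs.support X).
Proof.
rewrite supportE; apply: compactU; first exact: compact_skel1.
apply: compact_bigcup_fin => f; apply: continuous_compact.
  exact: face_polar_continuous.
by apply: compact_setX; exact: segment_compact.
Qed.

(* A cochain on the edges vanishing on face boundaries defines a map to R/Z;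
   contractibility lifts it to R. *)
Lemma cocycle_coboundary (z : edge X -> int) :
  contractible R (Defs.support X) ->
  (forall f, \sum_(e : edge X) z e * wind f e = 0) ->
  exists g : T -> R, forall e, (z e)%:~R = g (echar e 1) - g (echar e 0).
Proof.
move=> cX hz.
pose L f t : R := \sum_(e : edge X) (z e)%:~R * bd_lift f e t.
have cL f : {within `[0, 1], continuous (L f)}.
  apply: within_continuous_sum => e x; apply: cvgM; first exact: cvg_cst.
  exact: bd_lift_continuous.
(* Closedness of the cochain on [f] is exactly what makes its lift along the boundary close up. *)
have L01 f : L f 0 = L f 1.
  apply/esym/eqP; rewrite -subr_eq0 /L -sumrB; apply/eqP.
  under eq_bigr do rewrite -mulrBr -windE -intrM.
  by rewrite -(big_morph _ (@intrD R) (erefl : 0%:~R = 0)) hz.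
(* Polar coordinates are ambiguous at the centre and between [t = 0] and [t = 1]. Every choice gives
   the same [fc], because the factor [p.1] vanishes at the centre and [L f 0 = L f 1]. *)
pose polars f x := [set p : R * R |
  [/\ 0 <= p.1 < 1, 0 <= p.2 <= 1 & fchar f (polar p) = x]].
pose fc f x : R := let p := xget (0, 0) (polars f x) in p.1 * L f p.2.
have fc_notin f x : ~ open_face f x -> fc f x = 0.
  move=> h; rewrite /fc xgetPN ?mul0r // => p [hp _ e]; apply: h.
  by exists (polar p) => //; exact: open_disk_polar.
have fcE f s t : 0 <= s < 1 -> 0 <= t <= 1 ->
    fc f (fchar f (polar (s, t))) = s * L f t.
  move=> hs ht; rewrite /fc; set x := fchar f _.
  have : polars f x (s, t) by [].
  move/(xgetI (0, 0)); case: (xget _ _) => s' t' [/= hs' ht' e].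
  have e' : polar (s', t') = polar (s, t).
    by apply: (@fchar_inj _ _ X f) => //; rewrite inE; exact: open_disk_polar.
  have [||/= -> [->|]] := polar_eq _ _ e'; rewrite ?mul0r //=.
  - by case/andP: hs'.
  - by case/andP: hs.
  by case/turn_ends => // [->//|[[]-> []->]] //; rewrite L01.
(* Modulo 1, [u] wraps each edge [z e] times and is coned off radially over each face. Open cells
   are disjoint, so at most one summand is nonzero at a point. *)
pose u x : R := \sum_(e : edge X) (z e)%:~R * edge_coord e x +
  \sum_(f : face X) fc f x.
have u_skel x : skel1 x -> u x = \sum_(e : edge X) (z e)%:~R * edge_coord e x.
  move=> hx; rewrite /u [X in _ + X]big1 ?addr0 // => f _.
  by apply: fc_notin => /open_face_skel1.
have u_edge e t : 0 <= t <= 1 -> u (echar e t) - (z e)%:~R * t \is a Num.int.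
  move=> ht; rewrite u_skel; last exact: echar_skel1.
  have -> : (z e)%:~R * t = \sum_e' (z e')%:~R * ((e' == e)%:R * t).
    rewrite (bigD1 e) //= eqxx mul1r big1 ?addr0 // => e' /negbTE->.
    by rewrite mul0r mulr0.
  rewrite -sumrB rpred_sum // => e' _; rewrite -mulrBr rpredM ?intr_int //.
  exact: coord_echar_int.
have cu : contZ (Defs.support X) (Defs.support X) u.
  apply: (@contZS _ _ _ setT _ (Defs.support X)) => //.
  have cE := contZ_skel1 u_edge.
  have cF : contZ setT
      (\bigcup_(f : face X) ((fchar f \o polar) @` (`[0, 1] `*` `[0, 1]))) u.
    apply: contZ_bigcup => f.
    apply: (contZ_image hausT (l := fun p : R * R => p.1 * L f p.2)).
    - by apply: compact_setX; exact: segment_compact.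
    - exact: face_polar_continuous.
    - move=> p; apply: cvgM.
        exact: (continuous_subspaceT (fun p : R * R => @cvg_fst _ _ _ _ _)).
      move: p; apply/within_continuousP => p U [_ hp] hU.
      have /within_continuousP/(_ p.2 U hp hU) h := cL f.
      have c2 : (snd : R * R -> R) @ p --> p.2 by exact: cvg_snd.
      have : \forall q \near p, `[0, 1]%classic q.2 -> U (L f q.2) by exact: c2 h.
      by apply: filterS => q hq [_ hq2]; exact: hq.
    - move=> [s t] [/=]; rewrite !in_itv /= => /andP[s0 s1] ht.
      move: s1; rewrite le_eqVlt => /orP[/eqP->|s1].
        rewrite polar1 u_skel; last exact: bd_skel1.
        rewrite mul1r /L -sumrB rpred_sum // => e _.
        by rewrite -mulrBr rpredM ?intr_int //; exact: bd_liftP.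
      have hs : 0 <= s < 1 by rewrite s0.
      have xf : open_face f (fchar f (polar (s, t))).
        by exists (polar (s, t)) => //; exact: open_disk_polar.
      rewrite /u big1 ?add0r.
        rewrite (bigD1 f) //= fcE // big1 ?addr0 ?subrr ?rpred0 // => f' /eqP ne.
        by apply: fc_notin => h; apply: ne; exact: open_face_uniq h xf.
      move=> e _; rewrite coord_notin ?mulr0 // => h.
      by apply: (open_face_skel1 xf); right; exists e.
  move=> x eps _ e0; rewrite supportE.
  by apply: filterS2 (cE x eps I e0) (cF x eps I e0) => y hE hF [/hE|/hF].
have [g [cg hg]] := contZ_lift compact_support cX cu.
have supp e t : 0 <= t <= 1 -> Defs.support X (echar e t).
  by move=> ht; rewrite supportE; left; exact: echar_skel1.
exists g => e.
(* Along [e], both [g] and [z e * t] lift [u], so [h] is continuous and integer-valued, hence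
   constant. *)
pose h (t : R) := (z e)%:~R * t - g (echar e t).
have : h 0 = h 1.
  apply: int_continuous_const => //; last first.
    move=> t ht; have := rpredB (hg _ (supp e t ht)) (u_edge e t ht).
    by rewrite /h (_ : _ - _ - _ = (z e)%:~R * t - g (echar e t)) //; lra.
  have cz : {within `[0, 1], continuous (fun t : R => (z e)%:~R * t)}.
    exact/continuous_subspaceT/mulrl_continuous.
  move=> t; apply: cvgB; first exact: cz.
  move: t; apply/within_continuousP => t U /= ht hU.
  have /within_continuousP/(_ _ U (supp e t ht) hU) hn := cg.
  have /within_continuousP/(_ t _ ht hn) := @echar_continuous _ _ X e.
  apply: filterS => t' h' ht'; apply: h' => //; exact: supp.
by rewrite /h mulr0 mulr1; lra.
Qed.

End Complex.

(** * Exactness and the Euler characteristic *)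

(** With more unknowns than equations there is a nonzero rational solution; [d], the product of all
    its denominators, makes it integral. *)
Lemma int_homogeneous_solution (I : finType) (eqs : seq {ffun I -> int}) :
  (size eqs < #|I|)%N ->
  exists z : I -> int, (exists i, z i != 0) /\
    forall c, c \in eqs -> \sum_i z i * c i = 0.
Proof.
move=> lt_eqs.
pose M : 'M[rat]_(#|I|, size eqs) :=
  \matrix_(i, j) (nth 0 eqs j (enum_val i))%:~R.
have : kermx M != 0.
  rewrite -mxrank_eq0 mxrank_ker subn_eq0 -ltnNge.
  exact: leq_ltn_trans (rank_leq_col M) lt_eqs.
move=> /matrix0Pn[i0 [j0 nz]].
pose w i := kermx M i0 (enum_rank i).
pose d : int := \prod_i denq (w i).
have wd i : d%:~R * w i \is a Num.int.
  rewrite /d (bigD1 i) //= intrM mulrAC -[X in _ * X * _]divq_num_den.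
  by rewrite mulrCA mulfV ?intr_eq0 ?denq_neq0 // mulr1 rpredM // intr_int.
pose z i := Num.floor (d%:~R * w i).
have zE i : (z i)%:~R = d%:~R * w i by rewrite /z floorK.
have d0 : d != 0 by apply/prodf_neq0 => i _; exact: denq_neq0.
exists z; split.
  exists (enum_val j0); rewrite -(intr_eq0 rat) zE mulf_neq0 ?intr_eq0 //.
  by rewrite /w enum_valK.
move=> c /(nthP 0)[k ks <-]; apply/eqP; rewrite -(intr_eq0 rat) rmorph_sum /=.
have h : \sum_j kermx M i0 j * M j (Ordinal ks) = 0.
  by have /matrixP/(_ i0 (Ordinal ks)) := mulmx_ker M; rewrite mxE [RHS]mxE.
under eq_bigr do rewrite intrM zE -mulrA.
rewrite -mulr_sumr mulf_eq0; apply/orP; right; apply/eqP.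
rewrite -[RHS]h (reindex (fun i : 'I_#|I| => enum_val i)) /=.
  by apply: eq_bigr => i _; rewrite [M _ _]mxE /w enum_valK.
by exists enum_rank => i _; [exact: enum_valK|exact: enum_rankK].
Qed.

Section Exactness.
Context {R : realType} {T : topologicalType} (X : complex R T).
Implicit Types (v : vertex X) (e : edge X) (f : face X) (S : {set face X}).

Local Notation open_edge := (open_edge (@echar R T X)).

Definition bd_meets f e := exists t, open_edge e (bd f t).

Lemma bd_meetsP f e : bd_meets f e <-> exists k : 'I_(flen f), arc_edge k = e.
Proof.
split=> [[t]|[k <-]].
  have [s hs est] := turn_surj (circle_turn t); rewrite /bd -est -/(bd f s).
  have [k [->|/bd_arc h h']] := bd_cases f hs.
    by have [v <-] := bd_corner k => /open_edge_vchar.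
  by exists k; exact: open_edge_uniq h h'.
have [|t tk _] := @bd_arc_surj _ _ _ _ k (echar (arc_edge k) 2^-1).
  by exists 2^-1 => //=; apply/andP; split; lra.
by exists t; exact: bd_arc.
Qed.

Lemma wind_notmeets f e : ~ bd_meets f e -> wind f e = 0.
Proof.
move=> h; apply/eqP; rewrite -(intr_eq0 R) windE subr_eq0; apply/eqP/esym.
apply: int_continuous_const => //; first exact: bd_lift_continuous.
move=> t ht; have := bd_liftP f e ht; rewrite coord_notin ?sub0r ?rpredN //.
by move=> h'; apply: h; exists t.
Qed.

(** The boundary path runs through [e] only along side [k], so the lift is integral, hence constant,
    before and after that side. Were the winding number 0, the lift would have equal values at the
    two ends of the side, hence a repeated value inside it, against injectivity of the attaching map
    on the arc. *)
Lemma wind_free f (k : 'I_(flen f)) :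
  (forall l : 'I_(flen f), arc_edge l = arc_edge k -> l = k) ->
  wind f (arc_edge k) != 0.
Proof.
move=> free; rewrite -(intr_eq0 R) windE; set e := arc_edge k.
pose a : R := k%:R / (flen f)%:R; pose b : R := k.+1%:R / (flen f)%:R.
have ab : a < b by rewrite ltr_subdivision ?flen_gt0.
have [a0 b1] : 0 <= a /\ b <= 1 := subdivision_le1 (ltn_ord k).
have cL := @bd_lift_continuous _ _ _ f e.
have outside t : 0 <= t <= 1 -> ~ in_arc k t -> bd_lift f e t \is a Num.int.
  move=> ht tk; have := bd_liftP f e ht.
  suff no : ~ open_edge e (bd f t) by rewrite coord_notin // sub0r rpredN.
  have corner0 : ~ open_edge e (bd f 0).
    have := bd_corner (Ordinal (flen_gt0 f)); rewrite mul0r => -[v <-].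
    exact: open_edge_vchar.
  case/andP: ht => t0; rewrite le_eqVlt => /orP[/eqP->|t1].
    by rewrite /bd turn1.
  have [|l [->|tl]] := @bd_cases _ _ _ f t; first by rewrite t0.
    by have [v <-] := bd_corner l; exact: open_edge_vchar.
  move=> h; apply: tk; rewrite -(free l) //.
  exact: open_edge_uniq (bd_arc tl) h.
have La : bd_lift f e 0 = bd_lift f e a.
  apply: int_continuous_const => //.
    apply: continuous_subspaceW cL => t /=; rewrite !in_itv /= => /andP[? ?].
    by apply/andP; split; lra.
  move=> t /andP[t0 ta]; apply: outside; first by apply/andP; split; lra.
  by rewrite /in_arc -/a => /andP[? ?]; lra.
have Lb : bd_lift f e b = bd_lift f e 1.
  apply: int_continuous_const => //.
    apply: continuous_subspaceW cL => t /=; rewrite !in_itv /= => /andP[? ?].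
    by apply/andP; split; lra.
  move=> t /andP[t0 ta]; apply: outside; first by apply/andP; split; lra.
  by rewrite /in_arc -/b => /andP[? ?]; lra.
rewrite -Lb La subr_eq0; apply/eqP => Lab.
have inside t : a < t < b ->
    0 < edge_coord e (bd f t) < 1 /\
    edge_coord e (bd f t) - bd_lift f e t \is a Num.int.
  move=> ht; have /bd_arc/coord_in[h _] : in_arc k t by [].
  split => //; apply: bd_liftP; case/andP: ht => ? ?; apply/andP; split; lra.
have ia : bd_lift f e a \is a Num.int.
  apply: outside; first by apply/andP; split; lra.
  by rewrite /in_arc -/a ltxx.
have [||| s [t [hs ht /eqP st Lst]]] := @loop_not_injective R (bd_lift f e) a b ab.
- apply: continuous_subspaceW cL => t /=; rewrite !in_itv /= => /andP[? ?].
  by apply/andP; split; lra.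
- by [].
- move=> t /inside[/andP[c0 c1] ci]; apply/eqP => Lt.
  have : edge_coord e (bd f t) \is a Num.int.
    by rewrite -(subrK (bd_lift f e t) (edge_coord e _)) rpredD // Lt.
  by move=> /small_int; rewrite ger0_norm; [move=> h; have := h c1; lra|lra].
apply: st; apply: (@bd_arc_inj _ _ _ _ k) => //.
have [/andP[s0 s1] si] := inside s hs; have [/andP[t0 t1] ti] := inside t ht.
have d0 : edge_coord e (bd f s) - edge_coord e (bd f t) = 0.
  apply: small_int; last by rewrite ltr_norml; apply/andP; split; lra.
  have -> : edge_coord e (bd f s) - edge_coord e (bd f t) =
    (edge_coord e (bd f s) - bd_lift f e s) -
    (edge_coord e (bd f t) - bd_lift f e t) by rewrite Lst; lra.
  exact: rpredB.
have [_ <-] := coord_in (bd_arc (hs : in_arc k s)).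
have [_ <-] := coord_in (bd_arc (ht : in_arc k t)).
by rewrite -/e (subr0_eq d0).
Qed.

(** The image of the boundary circle is closed and contains the open edge, so it contains the ends
    too. *)
Lemma echar_closure f e t : bd_meets f e -> 0 <= t <= 1 ->
  exists s, bd f s = echar e t.
Proof.
move=> /bd_meetsP[k ke] /andP[t0 t1].
pose B := bd f @` `[0, 1].
have cB : closed B.
  apply: compact_closed; first exact: complex_hausdorff X.
  apply: continuous_compact; last exact: segment_compact.
  exact/continuous_subspaceT/bd_continuous.
have [[s _ <-]|nB] := pselect (B (echar e t)); first by exists s.
have oB : nbhs (echar e t) (~` B).
  by apply: open_nbhs_nbhs; split => //; exact: closed_openC.
have /within_continuousP/(_ t _ _ oB) h := @echar_continuous _ _ X e.
have tI : `[0, 1]%classic t by rewrite /= in_itv /= t0.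
have [|s hs nBs] := near_itv ltr01 _ (h tI); first by rewrite t0.
exfalso; apply: nBs; first by rewrite /= in_itv /=; case/andP: hs => /ltW-> /ltW->.
have [|r rk <-] := @bd_arc_surj _ _ _ _ k (echar e s); first by rewrite ke; exists s.
by exists r => //=; rewrite in_itv /=; have /andP[-> /ltW->] := in_arc01 rk.
Qed.

(** * Subcomplexes spanned by sets of faces *)

Definition edges_of S : {set edge X} :=
  [set e | `[< exists2 f, f \in S & bd_meets f e >]]%SET.

Definition vertices_of S : {set vertex X} :=
  [set v | `[< exists2 f, f \in S & exists t, bd f t = vchar v >]]%SET.

Lemma edges_ofP S e :
  reflect (exists2 f, f \in S & bd_meets f e) (e \in edges_of S).
Proof. by rewrite inE; exact: asboolP. Qed.

Lemma vertices_ofP S v :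
  reflect (exists2 f, f \in S & exists t, bd f t = vchar v) (v \in vertices_of S).
Proof. by rewrite inE; exact: asboolP. Qed.

Lemma end_ex e :
  {p : vertex X * vertex X | vchar p.1 = echar e 0 /\ vchar p.2 = echar e 1}.
Proof. by apply/cid; have [[v _ hv] [w _ hw]] := echar_end e; exists (v, w). Qed.

Definition src e := (projT1 (end_ex e)).1.
Definition dst e := (projT1 (end_ex e)).2.

Lemma vchar_src e : vchar (src e) = echar e 0.
Proof. by have [] := projT2 (end_ex e). Qed.

Lemma vchar_dst e : vchar (dst e) = echar e 1.
Proof. by have [] := projT2 (end_ex e). Qed.

Lemma src_vertices_of S e : e \in edges_of S -> src e \in vertices_of S.
Proof.
move=> /edges_ofP[f fS fe]; apply/vertices_ofP; exists f => //.
by rewrite vchar_src; apply: echar_closure; rewrite // lexx ler01.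
Qed.

Lemma dst_vertices_of S e : e \in edges_of S -> dst e \in vertices_of S.
Proof.
move=> /edges_ofP[f fS fe]; apply/vertices_ofP; exists f => //.
by rewrite vchar_dst; apply: echar_closure; rewrite // lexx ler01.
Qed.

(** Vanishing first cohomology of the subcomplex spanned by [S], for integral cochains with real
    potentials. *)
Definition exact_on S := forall z : edge X -> int,
  (forall f, f \in S -> \sum_(e : edge X) z e * wind f e = 0) ->
  exists g : vertex X -> R,
    forall e, e \in edges_of S -> (z e)%:~R = g (dst e) - g (src e).

Lemma exact_on_setT : contractible R (Defs.support X) -> exact_on [set: face X]%SET.
Proof.
move=> cX z hz; have [|g hg] := @cocycle_coboundary _ _ X z cX.
  by move=> f; exact: hz.
exists (g \o vchar (c := X)) => e _ /=.
by rewrite vchar_src vchar_dst.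
Qed.

(** A cochain closed on the other faces can be corrected on [e] alone to become closed on [f] as
    well, and [e] is no longer an edge once [f] is removed. *)
Lemma exact_on_remove S f e : exact_on S -> f \in S -> wind f e != 0 ->
  (forall f', f' \in S -> bd_meets f' e -> f' = f) -> exact_on (S :\ f)%SET.
Proof.
move=> exS fS w0 free z hz.
pose c := \sum_(e' : edge X) z e' * wind f e'.
(* Scaling by [wind f e] keeps the corrected cochain integral; the potential is divided by it at the
   end. *)
pose z' e' := wind f e * z e' - c * (e' == e)%:R.
have sumE f' : \sum_(e' : edge X) z' e' * wind f' e' =
    wind f e * (\sum_(e' : edge X) z e' * wind f' e') - c * wind f' e.
  under eq_bigr do rewrite /z' mulrBl -!mulrA.
  rewrite sumrB -!mulr_sumr; congr (_ - _ * _).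
  rewrite (bigD1 e) //= eqxx mul1r big1 ?addr0 // => e' /negbTE->.
  by rewrite mul0r.
have [f' f'S|g hg] := exS z'.
  rewrite sumE; have [->|ne] := eqVneq f' f; first by rewrite -/c mulrC subrr.
  rewrite hz ?inE ?ne // mulr0 wind_notmeets ?mulr0 ?subr0 // => h.
  by move/eqP: ne; apply; exact: free.
exists (fun v => g v / (wind f e)%:~R) => e' /edges_ofP[f'].
rewrite !inE => /andP[ne f'S] me'.
have ee' : e' != e.
  by apply/eqP => h; move/eqP: ne; apply; apply: free; rewrite -?h.
have := hg e'; rewrite /z' (negbTE ee') mulr0 subr0 intrM => h.
rewrite -mulrBl -h; last by apply/edges_ofP; exists f'.
by rewrite mulrC mulKf // intr_eq0.
Qed.

(* A harmonic cochain (closed, and orthogonal to all coboundaries) vanishes on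
   an exact complex; it exists for dimension reasons unless the Euler
   characteristic is positive. *)
Lemma exact_on_euler S : exact_on S -> (0 < #|S|)%N ->
  (#|edges_of S| < #|vertices_of S| + #|S|)%N.
Proof.
move=> exS /card_gt0P[f0 f0S]; rewrite ltnNge; apply/negP => le_E.
have [v0 v0E] := bd_corner (Ordinal (flen_gt0 f0)).
have v0S : v0 \in vertices_of S.
  by apply/vertices_ofP; exists f0 => //; eexists; rewrite v0E.
pose inc v e : int := (dst e == v)%:R - (src e == v)%:R.
(* The conditions are: zero off the edges of [S], closed on [S], and zero divergence at every vertex
   other than [v0]. Leaving out [v0] makes the equations fewer than the unknowns. *)
pose eqs : seq {ffun edge X -> int} :=
  [seq [ffun e' => (e' == e)%:R] | e <- enum (~: edges_of S)%SET] ++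
  [seq [ffun e => wind f e] | f <- enum S] ++
  [seq [ffun e => inc v e] | v <- enum (vertices_of S :\ v0)%SET].
have [|z [[e1 ze1] hz]] := @int_homogeneous_solution _ eqs.
  rewrite !size_cat !size_map -!cardE.
  have := cardsC (edges_of S); have := cardsD1 v0 (vertices_of S); rewrite v0S.
  move: le_E; clear; lia.
have z_out e : e \notin edges_of S -> z e = 0.
  move=> he; have := hz [ffun e' => (e' == e)%:R].
  rewrite (bigD1 e) //= ffunE eqxx mulr1 big1 ?addr0; last first.
    by move=> e' /negbTE ne; rewrite ffunE ne mulr0.
  apply; rewrite mem_cat; apply/orP; left; apply/mapP; exists e => //.
  by rewrite mem_enum inE.
have [f fS|g hg] := exS z.
  have := hz [ffun e => wind f e].
  under eq_bigr do rewrite ffunE.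
  apply; rewrite !mem_cat; apply/orP; right; apply/orP; left; apply/mapP.
  by exists f => //; rewrite mem_enum.
have z_inc v : v \in vertices_of S -> v != v0 ->
    \sum_(e : edge X) (z e)%:~R * (inc v e)%:~R = 0 :> R.
  move=> vS v_v0; have := hz [ffun e => inc v e].
  under eq_bigr do rewrite ffunE.
  under [in X in _ -> X]eq_bigr do rewrite -intrM.
  rewrite -(big_morph _ (@intrD R) (erefl : 0%:~R = 0)) => -> //.
  rewrite !mem_cat; apply/orP; right; apply/orP; right; apply/mapP; exists v => //.
  by rewrite mem_enum !inE v_v0; exact/asboolP/vertices_ofP.
(* The potential is normalised to vanish at [v0], where no divergence condition was imposed. *)
pose G v := g v - g v0.
have z_G e : (z e)%:~R * (z e)%:~R =
    \sum_(v in vertices_of S) G v * ((z e)%:~R * (inc v e)%:~R).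
  have [eS|/z_out ->] := boolP (e \in edges_of S); last first.
    by rewrite mul0r big1 // => v _; rewrite mul0r mulr0.
  under eq_bigr do rewrite mulrCA.
  rewrite -mulr_sumr; congr (_ * _).
  have pick (w : vertex X) : w \in vertices_of S ->
      \sum_(v in vertices_of S) G v * (w == v)%:R = G w.
    move=> wS; rewrite (bigD1 w) //= eqxx mulr1 big1 ?addr0 // => v /andP[_ ne].
    by rewrite eq_sym (negbTE ne) mulr0.
  rewrite hg // (_ : g (dst e) - g (src e) = G (dst e) - G (src e)); last first.
    by rewrite /G; lra.
  rewrite -(pick _ (dst_vertices_of eS)) -(pick _ (src_vertices_of eS)) -sumrB.
  by apply: eq_bigr => v _; rewrite -mulrBr /inc intrB !natz.
have : \sum_(e : edge X) (z e)%:~R * (z e)%:~R = 0 :> R.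
  under eq_bigr do rewrite z_G.
  rewrite exchange_big /= big1 // => v vS; rewrite -mulr_sumr.
  have [->|ne] := eqVneq v v0; first by rewrite /G subrr mul0r.
  by rewrite z_inc ?mulr0.
move/psumr_eq0P => h; have := h (fun e _ => sqr_ge0 ((z e)%:~R : R)) e1 isT.
by apply/eqP; rewrite mulf_neq0 // intr_eq0.
Qed.

End Exactness.

(** * Tops of a stacking *)

Section Heights.
Context {R : realType} {T : topologicalType} (X : complex R T).
Implicit Types (v : vertex X) (e : edge X) (f g : face X) (S : {set face X}).
Variable H : face X -> plane R -> R.
Hypothesis H_continuous : forall f, {within @circle R, continuous (H f)}.
Hypothesis H_sep : forall f g p q, circle p -> circle q ->
  fchar f p = fchar g q -> H f p = H g q -> f = g /\ p = q.
Hypothesis immersedX : immersed_boundaries X.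

Local Notation open_edge := (open_edge (@echar R T X)).

Definition ht f (t : R) : R := H f (turn t).

Lemma ht_continuous f : continuous (ht f).
Proof.
move=> t U Ut; change (\forall s \near t, U (ht f s)).
have /within_continuousP/(_ _ U (circle_turn t) Ut) h := @H_continuous f.
have : \forall s \near t, circle (turn s) -> U (ht f s) by exact: turn_continuous h.
by apply: filterS => s; apply; exact: circle_turn.
Qed.

(** Heights are an arbitrary separating function [H], so that the same results apply to [- H], whose
    tops are the lowest points. *)
Definition top S f t := forall g s, g \in S -> bd g s = bd f t -> ht g s <= ht f t.

Lemma top_turn S f s t : turn s = turn t -> top S f s -> top S f t.
Proof. by rewrite /top /bd /ht => ->. Qed.

Lemma ht_lt_near f g s t : ht f s < ht g t ->
  \forall s' \near s & t' \near t, ht f s' < ht g t'.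
Proof.
move=> h; pose m := (ht f s + ht g t) / 2.
exists ([set s' | ht f s' < m], [set t' | m < ht g t']) => /=.
  have [h1 h2] : ht f s < m /\ m < ht g t by rewrite /m; split; lra.
  by split; [exact: cvgr_lt (@ht_continuous f s) _ h1|
             exact: cvgr_gt (@ht_continuous g t) _ h2].
by move=> [s' t'] /= [h1 h2]; exact: lt_trans h1 h2.
Qed.

(** Strictly lower points of the fibre stay lower nearby. A point of the same height is the point
    itself by [H_sep], and there immersedness leaves no second point in nearby fibres. *)
Lemma top_near S f t : top S f t -> \forall s \near t, top S f s.
Proof.
move=> ft.
have key g : \forall s \near t, forall r, `[0, 1]%classic r -> bd g r = bd f s ->
    bd g r = bd f s -> g \in S -> ht g r <= ht f s.
  apply: (@near_fiber _ _ _ (nbhs t) (`[0, 1]%classic : set R) (bd g) (bd f)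
    (bd f t) (fun s r => bd g r = bd f s -> g \in S -> ht g r <= ht f s)).
  - exact: complex_hausdorff X.
  - exact: segment_compact.
  - exact/continuous_subspaceT/bd_continuous.
  - exact: bd_continuous.
  move=> r hr e; have [gS|gS] := boolP (g \in S); last first.
    by near=> p => _ _.
  have := ft g r gS e; rewrite le_eqVlt => /orP[/eqP eh|lt_h].
    have [fg tr] := H_sep (circle_turn r) (circle_turn t) e eh.
    subst g; have [U Ut Uinj] := immersedX f (circle_turn t).
    exists ([set r' | U (turn r')], [set s | U (turn s)]) => /=.
      split; apply: turn_continuous => //.
      by move: Ut; rewrite -tr.
    move=> [r' s] /= [Ur Us] _ e' _; rewrite /ht.
    rewrite (_ : turn r' = turn s) //; apply: Uinj => //; rewrite inE.
      by split => //; exact: circle_turn.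
    by split => //; exact: circle_turn.
  have := ht_lt_near lt_h; apply: filterS => -[r' s] /= h _ _ _; exact: ltW.
have := filter_forall (nbhs_filter t) key; apply: filterS => s hs g r gS e.
have [r' /andP[r0 r1] er] := turn_surj (circle_turn r).
have e' : bd g r' = bd f s by rewrite -e /bd er.
have := hs g r' _ e' e' gS; rewrite /ht er; apply.
by rewrite /= in_itv /= r0 ltW.
Unshelve. all: by end_near. Qed.

(** A point above [t] lies on a side over the same open edge. That side covers the whole edge, so it
    also has a point above each nearby [s]. *)
Lemma nottop_near S f (k : 'I_(flen f)) t : in_arc k t -> ~ top S f t ->
  \forall s \near t, ~ top S f s.
Proof.
move=> tk /existsNP[g /existsNP[r0 /not_implyP[gS /not_implyP[e0 /negP]]]].
rewrite -ltNge.
have [r hr er] := turn_surj (circle_turn r0).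
rewrite /ht -er -/(ht g r) -/(ht f t) => lt_h.
have e : bd g r = bd f t by rewrite /bd er.
have ek := bd_arc tk.
have [j [rj|rj]] := bd_cases g hr.
  exfalso; move: ek; rewrite -e rj; have [v <-] := bd_corner j.
  exact: open_edge_vchar.
have ej : arc_edge j = arc_edge k.
  by apply: open_edge_uniq ek; rewrite -e; exact: bd_arc.
(* The closed arc is used for compactness; its two ends map to vertices and so miss the fibre. *)
pose n : R := (flen g)%:R.
have key : \forall s \near t, forall r', `[j%:R / n, j.+1%:R / n]%classic r' ->
    bd g r' = bd f s -> ht f s < ht g r'.
  apply: (@near_fiber _ _ _ (nbhs t) (`[j%:R / n, j.+1%:R / n]%classic : set R)
    (bd g) (bd f) (bd f t) (fun s r' => ht f s < ht g r')).
  - exact: complex_hausdorff X.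
  - exact: segment_compact.
  - exact/continuous_subspaceT/bd_continuous.
  - exact: bd_continuous.
  move=> r' /=; rewrite in_itv /= => /andP[h1 h2] e'.
  have r'j : in_arc j r'.
    apply/andP; split; rewrite lt_neqAle ?h1 ?h2 andbT; apply/eqP => h.
      by move: ek; rewrite -e' -h; have [v <-] := bd_corner j => /open_edge_vchar.
    by move: ek; rewrite -e' h; have [v <-] := bd_corner_succ j => /open_edge_vchar.
  have -> : r' = r by apply: (bd_arc_inj r'j rj); rewrite e e'.
  have [[A B] /= [At Br] AB] := ht_lt_near lt_h.
  by exists (B, A) => // -[x y] /= [Bx Ay] _; exact: (AB (y, x)).
have kt : \forall s \near t, in_arc k s.
  case/andP: tk => tk1 tk2.
  have n1 : \forall s \near t, k%:R / (flen f)%:R < s by exact: lt_nbhsr.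
  have n2 : \forall s \near t, s < k.+1%:R / (flen f)%:R.
    exact: cvgr_lt cvg_id _ tk2.
  by apply: filterS2 n1 n2 => s h1 h2; apply/andP.
apply: filterS2 key kt => s hs /bd_arc; rewrite -ej => /bd_arc_surj[r' r'j e'] st.
have := st g r' gS e'; rewrite leNgt hs //= in_itv /=.
by case/andP: r'j => /ltW-> /ltW->.
Qed.

Lemma top_arc S f (k : 'I_(flen f)) s t : in_arc k s -> in_arc k t ->
  top S f s -> top S f t.
Proof.
have key a b : a <= b -> in_arc k a -> in_arc k b -> top S f a <-> top S f b.
  move=> ab /andP[a1 a2] /andP[b1 b2].
  apply: locally_constant => // x /andP[x1 x2]; first by move=> ?; exact: top_near.
  by apply: (@nottop_near _ _ k); apply/andP; split; lra.
by case: (leP s t) => [st|/ltW ts] hs ht; [have [] := key s t st hs ht|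
  have [] := key t s ts ht hs].
Qed.

Definition arc_top S f (k : 'I_(flen f)) := forall t, in_arc k t -> top S f t.

Lemma corner_lt f (k : 'I_(flen f)) :
  k%:R / (flen f)%:R < k.+1%:R / (flen f)%:R :> R.
Proof. by rewrite ltr_subdivision ?flen_gt0. Qed.

Lemma arc_top_near S f (k : 'I_(flen f)) t : top S f t ->
  k%:R / (flen f)%:R <= t <= k.+1%:R / (flen f)%:R -> arc_top S k.
Proof.
move=> /top_near ft ht; have [s sk st] := near_itv (corner_lt k) ht ft.
by move=> r rk; exact: top_arc sk rk st.
Qed.

(** Walk backwards around the circle: a top corner makes the preceding side top, and without a gap
    the corner starting that side is top again. *)
Lemma full_or_gap S f : (exists t, top S f t) ->
  (forall t, top S f t) \/
  exists k : 'I_(flen f), arc_top S k /\ ~ top S f (k%:R / (flen f)%:R).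
Proof.
move=> [t0 ft0].
have [?|gap] := pselect (exists k : 'I_(flen f),
  arc_top S k /\ ~ top S f (k%:R / (flen f)%:R)); [by right|left].
have n0 := flen_gt0 f; set n : R := (flen f)%:R.
have nz : n != 0 by rewrite pnatr_eq0 -lt0n.
have step (k : 'I_(flen f)) : arc_top S k -> top S f (k%:R / n).
  by move=> kA; apply: contrapT => h; apply: gap; exists k.
have down (m : nat) : (m < flen f)%N -> top S f (m.+1%:R / n) -> top S f (m%:R / n).
  move=> mn h; apply: (step (Ordinal mn)); apply: arc_top_near h _.
  by rewrite lexx andbT ltW // (corner_lt (Ordinal mn)).
have downs (m d : nat) : (m + d <= flen f)%N ->
    top S f ((m + d)%:R / n) -> top S f (m%:R / n).
  elim: d => [|d IH] hd; first by rewrite addn0.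
  by rewrite addnS => /down h; apply: IH; [lia|apply: h; lia].
have [k kt] : exists k : 'I_(flen f), top S f (k%:R / n).
  have [t ht e] := turn_surj (circle_turn t0).
  have ft := top_turn (esym e) ft0.
  have [k [tk|tk]] := bd_cases f ht; exists k; first by rewrite -tk.
  by apply: step => s sk; exact: top_arc tk sk ft.
(* Descending from corner [k] reaches parameter 0, the same point as parameter 1; descending from
   there reaches every corner. *)
have top0 : top S f 0.
  rewrite -(mul0r n^-1); apply: (@downs 0 k); first by have := ltn_ord k; lia.
  by [].
have corners (m : nat) : (m <= flen f)%N -> top S f (m%:R / n).
  move=> mn; apply: (@downs m (flen f - m)%N); first lia.
  by rewrite subnKC // divff //; apply: top_turn top0; rewrite turn1.
move=> t; have [s hs e] := turn_surj (circle_turn t); apply: top_turn e _.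
have [l [->|sl]] := bd_cases f hs; first by apply: corners; exact: ltnW.
apply: (arc_top_near (k := l) _ _ sl); first by apply: (corners l); exact: ltnW.
by rewrite lexx ltW // corner_lt.
Qed.

(** A pair of a face and an index stands both for a side and for the corner where it starts, so
    corners and sides are counted in one type. *)
Definition flag := {f : face X & 'I_(flen f)}.

Definition flag_vertex (x : flag) : vertex X :=
  projT1 (cid (bd_corner (tagged x))).

Lemma flag_vertexE (x : flag) :
  vchar (flag_vertex x) = bd (tag x) ((tagged x)%:R / (flen (tag x))%:R).
Proof. exact: projT2 (cid (bd_corner (tagged x))). Qed.

Definition top_corners S : {set flag} := [set x : flag | (tag x \in S) &&
  `[< top S (tag x) ((tagged x)%:R / (flen (tag x))%:R) >]]%SET.

Definition top_arcs S : {set flag} :=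
  [set x : flag | (tag x \in S) && `[< arc_top S (tagged x) >]]%SET.

Lemma top_corners_sub S : top_corners S \subset top_arcs S.
Proof.
apply/fintype.subsetP => x; rewrite !inE => /andP[-> /asboolP h] /=; apply/asboolP.
by apply: arc_top_near h _; rewrite lexx ltW // corner_lt.
Qed.

(** Every boundary point over a vertex is a corner, so the highest of the finitely many corners of
    [S] there is top. *)
Lemma card_vertices_of S : (#|vertices_of S| <= #|top_corners S|)%N.
Proof.
apply: leq_trans (leq_imset_card flag_vertex _); apply/subset_leq_card/fintype.subsetP.
move=> v /vertices_ofP[f0 f0S [t0 e0]].
have corner_of f t : bd f t = vchar v ->
    exists k : 'I_(flen f), turn t = turn (k%:R / (flen f)%:R).
  move=> e; have [s hs es] := turn_surj (circle_turn t).
  have [k [sk|sk]] := bd_cases f hs; exists k; rewrite -es ?sk //.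
  exfalso; apply: (@open_edge_vchar _ _ X (arc_edge k) v).
  by rewrite -e /bd -es; exact: bd_arc.
pose P (x : flag) := (tag x \in S) && (flag_vertex x == v).
pose h (x : flag) := ht (tag x) ((tagged x)%:R / (flen (tag x))%:R).
have flagP f (k : 'I_(flen f)) : bd f (k%:R / (flen f)%:R) = vchar v -> f \in S ->
    P (Tagged _ k).
  move=> e fS; rewrite /P fS /=; apply/eqP/(@vchar_inj _ _ X).
  by rewrite flag_vertexE.
have [k0 ek0] := corner_of _ _ e0.
have Px0 : P (Tagged (fun f => 'I_(flen f)) k0).
  by apply: flagP => //; rewrite /bd -ek0.
have [x /andP[xS /eqP xv] xmax] := @arg_maxP _ R flag _ P h Px0.
apply/imsetP; exists x => //; rewrite inE xS /=; apply/asboolP => g s gS.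
rewrite -flag_vertexE xv => e; have [k ek] := corner_of _ _ e.
have := xmax (Tagged (fun f => 'I_(flen f)) k); rewrite /h /= /ht -ek; apply.
by apply: flagP => //; rewrite /bd -ek.
Qed.

(** Two top sides over one edge have equal heights over its midpoint, so [H_sep] identifies them. *)
Lemma card_top_arcs S : (#|top_arcs S| <= #|edges_of S|)%N.
Proof.
have inj : {in top_arcs S &, injective (fun x : flag => arc_edge (tagged x))}.
  move=> [f k] [g l]; rewrite !inE /= => /andP[fS /asboolP ft] /andP[gS /asboolP gt] e.
  have [|s sk es] := @bd_arc_surj _ _ _ _ k (echar (arc_edge k) 2^-1).
    by exists 2^-1 => //=; apply/andP; split; lra.
  have [|r rl er] := @bd_arc_surj _ _ _ _ l (echar (arc_edge k) 2^-1).
    by rewrite -e; exists 2^-1 => //=; apply/andP; split; lra.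
  have esr : bd f s = bd g r by rewrite es er.
  have eh : ht f s = ht g r.
    by apply/le_anti; rewrite (gt r rl f s) ?(ft s sk g r).
  have [fg tsr] := H_sep (circle_turn s) (circle_turn r) esr eh.
  subst g; have sr := turn_inj (in_arc01 sk) (in_arc01 rl) tsr.
  by rewrite sr in sk; rewrite (in_arc_uniq sk rl).
rewrite -(card_in_imset inj); apply/subset_leq_card/fintype.subsetP.
move=> _ /imsetP[[f k] + ->]; rewrite inE => /andP[fS _] /=.
by apply/edges_ofP; exists f => //; apply/bd_meetsP; exists k.
Qed.

Lemma full_top_ex S : exact_on S -> (0 < #|S|)%N ->
  (forall f, f \in S -> exists t, top S f t) ->
  exists2 f, f \in S & forall t, top S f t.
Proof.
move=> exS S0 goodS; apply: contrapT => nofull.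
have gap f : f \in S -> exists k : 'I_(flen f),
    arc_top S k /\ ~ top S f (k%:R / (flen f)%:R).
  move=> fS; have [full|//] := full_or_gap (goodS f fS).
  by exfalso; apply: nofull; exists f.
(* A gap is a flag whose side is top but whose corner is not; each face of [S] contributes one of
   its own. *)
have SA : (#|S| <= #|top_arcs S :\: top_corners S|)%N.
  apply: leq_trans (leq_imset_card (fun x : flag => tag x) _).
  apply/subset_leq_card/fintype.subsetP => f fS; have [k [kA kC]] := gap f fS.
  apply/imsetP; exists (Tagged (fun f => 'I_(flen f)) k) => //.
  rewrite !inE /= fS /=; apply/andP; split; last exact/asboolP.
  by apply/asboolP.
have := exact_on_euler exS S0.
have := card_vertices_of S; have := card_top_arcs S; move: SA.
rewrite cardsD (finset.setIidPr (top_corners_sub S)).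
by have := subset_leq_card (top_corners_sub S); lia.
Qed.

End Heights.

(** * Removing sinks one at a time *)

Section Acyclicity.
Context {R : realType} {T : topologicalType} (X : complex R T).
Implicit Types (f g : face X) (S : {set face X}).

(** By openness, [f] is lowest at some point inside a side [k]. There it is both highest and lowest,
    so the fibre is a single point, whereas any other side over the same edge would meet it. *)
Lemma full_top_free (H : face X -> plane R -> R) S f :
  (forall f, {within @circle R, continuous (H f)}) ->
  (forall f g p q, circle p -> circle q ->
    fchar f p = fchar g q -> H f p = H g q -> f = g /\ p = q) ->
  immersed_boundaries X ->
  f \in S -> (forall t, top H S f t) ->
  (exists t, top (fun f p => - H f p) S f t) ->
  exists k : 'I_(flen f),
    (forall g, g \in S -> bd_meets g (arc_edge k) -> g = f) /\
    (forall l : 'I_(flen f), arc_edge l = arc_edge k -> l = k).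
Proof.
move=> Hc Hsep imm fS ftop [t0 fbot0].
have Hc' g : {within @circle R, continuous (fun p => - H g p)}.
  by move=> x; apply: cvgN; exact: Hc.
have Hsep' g g' p q : circle p -> circle q -> fchar g p = fchar g' q ->
    - H g p = - H g' q -> g = g' /\ p = q.
  by move=> cp cq e /oppr_inj; exact: Hsep.
have [k [s sk fbot]] : exists k : 'I_(flen f), exists2 s, in_arc k s &
    top (fun f p => - H f p) S f s.
  have [t ht e] := turn_surj (circle_turn t0).
  have fbot := top_turn (esym e) fbot0.
  have [k [tk|tk]] := bd_cases f ht; exists k; last by exists t.
  have /(near_itv (corner_lt k)) := top_near Hc' Hsep' imm fbot.
  by move=> h; apply: h; rewrite -tk lexx tk ltW // corner_lt.
have only g (l : 'I_(flen g)) : g \in S -> arc_edge l = arc_edge k ->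
    exists2 r, in_arc l r & f = g /\ turn s = turn r.
  move=> gS lk; have := bd_arc sk; rewrite -lk => /bd_arc_surj[r rl e].
  exists r => //; apply: Hsep; [exact: circle_turn|exact: circle_turn|exact: esym|].
  apply/le_anti/andP; split; last exact: (ftop s g r gS e).
  by have := fbot g r gS e; rewrite /ht lerN2.
exists k; split.
  by move=> g gS /bd_meetsP[l lk]; have [r _ []] := only g l gS lk.
move=> l lk; have [r rl [_ /turn_inj e]] := only f l fS lk.
by apply: (in_arc_uniq rl); rewrite -e //; [exact: in_arc01 sk|exact: in_arc01 rl].
Qed.

(** An edge leaving [f] would put a side of [g] above a side of [f] over the midpoint of [e]. *)
Lemma full_top_sink (Psi : face X -> plane R -> T * R) S f g :
  g \in S -> (forall t, top (fun f p => (Psi f p).2) S f t) ->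
  ~ dual_graph Psi f g.
Proof.
move=> gS ftop /asboolP[e [_ [i [j [fi gj low]]]]].
have ex : open_edge (@echar R T X) e (echar e 2^-1).
  by exists 2^-1 => //=; apply/andP; split; lra.
have := ex; rewrite -fi => -[p pi ep].
have := ex; rewrite -gj => -[q qj eq_].
have := low p q pi qj; rewrite ep eq_ => /(_ erefl).
case: pi qj ep eq_ => s _ <- [r _ <-] es er.
by rewrite ltNge => /negP; apply; apply: (ftop s g r gS); rewrite /bd es er.
Qed.

Theorem good_stacking_acyclic (Psi : face X -> plane R -> T * R) :
  contractible R (Defs.support X) -> immersed_boundaries X ->
  good_stacking Psi -> acyclic (dual_graph Psi).
Proof.
move=> cX imm [[Pc Pinj Pbd] good] c c0; apply/negP => cyc.
pose H f p := (Psi f p).2.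
have Hc f : {within @circle R, continuous (H f)}.
  by move=> x; apply: (cvg_comp _ _ (Pc f x)); exact: cvg_snd.
have Hsep f g p q : circle p -> circle q -> fchar f p = fchar g q ->
    H f p = H g q -> f = g /\ p = q.
  move=> cp cq e eh; apply: Pinj => //.
  by rewrite [LHS]surjective_pairing [RHS]surjective_pairing !Pbd // e -/(H f p) eh.
have topS S f : exists t, top H S f t.
  have [h [_ [/turn_surj[t _ <-] _ _ ht]]] := good f.
  by exists t => g s _ e; apply: ht => //; exact: circle_turn.
have botS S f : exists t, top (fun f p => - H f p) S f t.
  have [_ [l [_ /turn_surj[t _ <-] lt _]]] := good f.
  by exists t => g s _ e; rewrite /ht lerN2; apply: lt => //; exact: circle_turn.
(* The cycle is kept inside a shrinking exact set of faces, which must finally be empty. *)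
suff no_exact n S : (#|S| <= n)%N -> exact_on S -> {subset c <= S} -> False.
  apply: (no_exact #|face X| [set: face X]%SET) => [||f _].
  - by rewrite cardsT.
  - exact: exact_on_setT.
  - by rewrite inE.
have [f0 f0c] : exists f0, f0 \in c.
  by case: c c0 {cyc} => // f0 c _; exists f0; exact: mem_head.
have succ f : f \in c -> exists2 g, g \in c & dual_graph Psi f g.
  by move=> fc; exists (next c f); rewrite ?mem_next // (next_cycle cyc).
elim: n S => [|n IH] S Sn exS cS.
  by move: Sn (cS _ f0c); rewrite leqn0 => /eqP/cards0_eq->; rewrite inE.
have S0 : (0 < #|S|)%N by apply/card_gt0P; exists f0; exact: cS.
have [f fS ftop] := full_top_ex Hc Hsep imm exS S0 (fun f _ => topS S f).
have [k [kfree kuniq]] := full_top_free Hc Hsep imm fS ftop (botS S f).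
apply: (IH (S :\ f)%SET).
- by have := cardsD1 f S; rewrite fS; lia.
- exact: exact_on_remove exS fS (wind_free kuniq) kfree.
(* The removed face is not on the cycle, since its successor there would be a face of [S] reached
   from a sink. *)
- move=> g gc; rewrite !inE cS // andbT; apply/eqP => gf.
  have [g' g'c] := succ g gc; rewrite gf.
  by apply: full_top_sink ftop; exact: cS.
Qed.

End Acyclicity.

Theorem lemma4p3 (R : realType) (D : disk_diagram R)
  (Psi : face D -> plane R -> (plane R * R)%type) (hPsi : good_stacking Psi) :
  acyclic (dual_graph Psi).
Proof.
exact: good_stacking_acyclic (diagram_contractible D) (@diagram_immersed _ D) hPsi.
Qed.
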